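(* Let $b\ge2$ be an integer, $\lambda\in(1/b,1)$, and let $\phi$ be a $\mathbb{Z}$-periodic, continuous, piecewise $C^2$ function such that $W=W^\phi_{\lambda,b}$ is not Lipschitz. Then for every $\varepsilon>0$ there is $M(\varepsilon)$, for every $m\ge M(\varepsilon)$ there is $K(\varepsilon,m)$, and for every $k\ge K(\varepsilon,m)$ there is $N(\varepsilon,m,k)$ such that for all $n\ge N(\varepsilon,m,k)$, all $t\in\mathbb{N}$, all $\mathbf{j}\in\Sigma$ and all $\mathbf{u}\in\Lambda^{\hat t}$, $\nu^{\mathbb{Z}_+}\Big(\big\{\mathbf{i}=i_1i_2\cdots\in\Sigma:\ \pi_{\mathbf{j}}g_{\mathbf{u}}g_{i_1i_2\cdots i_{\hat n}}\mu\text{ is }(\alpha,\varepsilon,m)\text{-entropy porous from scale }t+n+1\text{ to }t+n+k\big\}\Big)>1-\varepsilon.$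
   Context: $W(x)=\sum_{n\ge0}\lambda^n\phi(b^nx)$; $\mu$ is the pushforward of Lebesgue measure on $[0,1)$ under $x\mapsto(x,W(x))$. $\Lambda=\{0,\dots,b-1\}$, $\Sigma=\Lambda^{\mathbb{Z}_+}$, $\nu^{\mathbb{Z}_+}$ the uniform Bernoulli measure. $\gamma=1/(b\lambda)$, $Y(x,\mathbf{j})=-\sum_{n\ge1}\gamma^n\phi'\!\left(\frac{x}{b^n}+\frac{j_1}{b^n}+\cdots+\frac{j_n}{b}\right)$, $\Gamma_{\mathbf{j}}(x)=\int_0^xY(t,\mathbf{j})dt$, $\pi_{\mathbf{j}}(x,y)=y-\Gamma_{\mathbf{j}}(x)$. $g_i(x,y)=\left(\frac{x+i}{b},\lambda y+\phi\!\left(\frac{x+i}{b}\right)\right)$, $g_{i_1\cdots i_n}=g_{i_1}\circ\cdots\circ g_{i_n}$. For $n\in\mathbb{N}$, $\hat n$ is the unique integer with $\lambda^{\hat n}\le b^{-n}<\lambda^{\hat n-1}$. $\alpha$ is the constant (from Ledrappier's theorem) such that $\pi_{\mathbf{j}}\mu$ is exact-dimensional of dimension $\alpha$ for $\nu^{\mathbb{Z}_+}$-a.e. $\mathbf{j}$. $\mathcal{L}_n$ is the partition of $\mathbb{R}$ into intervals $[j/b^n,(j+1)/b^n)$, $j\in\mathbb{Z}$; $\mathcal{L}_n(x)$ is the interval containing $x$. For a probability measure $\omega$ on $\mathbb{R}$, $H(\omega,\mathcal{Q})=-\sum_{Q\in\mathcal{Q}}\omega(Q)\log_b\omega(Q)$,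 and $\omega_{x,i}=\omega(\cdot\cap\mathcal{L}_i(x))/\omega(\mathcal{L}_i(x))$ when $\omega(\mathcal{L}_i(x))>0$. $\omega$ is $(h,\delta,m)$-entropy porous from scale $n_1$ to $n_2$ if $\frac{1}{n_2-n_1+1}\sum_{i=n_1}^{n_2}\omega\big(\{x:\frac1mH(\omega_{x,i},\mathcal{L}_{i+m})<h+\delta\}\big)>1-\delta$. *)

(* Defs.v *)
From HB Require Import structures.
From mathcomp Require Import all_boot all_order all_algebra.
From mathcomp Require Import all_classical all_reals all_analysis.
Unset Printing Implicit Defensive.
Import Order.TTheory GRing.Theory Num.Theory.
Import numFieldNormedType.Exports.
Local Open Scope classical_set_scope.
Local Open Scope ring_scope.

Definition Zperiodic {R : realType} (phi : R -> R) : Prop :=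
  forall x, phi (x + 1) = phi x.

Definition C2fun {R : realType} (psi : R -> R) : Prop :=
  [/\ forall x, derivable psi x 1,
      forall x, derivable (derive1 psi) x 1 &
      continuous (derive1 (derive1 psi))].

Definition piecewise_C2 {R : realType} (phi : R -> R) : Prop :=
  exists (N : nat) (a : nat -> R),
    [/\ a 0%N = 0, a N = 1,
        forall k, (k < N)%N -> a k < a k.+1 &
        forall k, (k < N)%N -> exists psi : R -> R,
          C2fun psi /\ forall x, a k <= x <= a k.+1 -> psi x = phi x].

Definition Wfun {R : realType} (lam : R) (b : nat) (phi : R -> R) (x : R) : R :=
  limn (fun N => \sum_(0 <= n < N) lam ^+ n * phi (b%:R ^+ n * x)).

(* A sequence j_1 j_2 ... is represented by j : nat -> 'I_b with j_k = j (k-1). *)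

Definition cyl {b : nat} (w : seq 'I_b) : set (nat -> 'I_b) :=
  [set i | forall k, (k < size w)%N -> i k = nth (i k) w k].

(* The uniform Bernoulli measure nu^{Z_+}, given by its (Caratheodory) outer
   measure built from the premeasure [w] |-> b^{-|w|} on cylinders. On
   measurable sets (in particular on sets depending on finitely many
   coordinates) this is the Bernoulli measure itself. *)
Definition nu_outer (R : realType) (b : nat) (A : set (nat -> 'I_b)) : \bar R :=
  ereal_inf [set s : \bar R | exists c : nat -> seq 'I_b,
    A `<=` \bigcup_n cyl (c n) /\
    s = (\sum_(n <oo) ((b%:R : R) ^- size (c n))%:E)%E].

Definition gam {R : realType} (lam : R) (b : nat) : R := (b%:R * lam)^-1.

(* Y(x,j) = - sum_{n>=1} gamma^n phi'(x/b^n + j_1/b^n + ... + j_n/b) ;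
   phi' is the derivative of phi (derive1; its value at the finitely many
   break points per period is irrelevant for Gamma). *)
Definition Yfun {R : realType} (lam : R) (b : nat) (phi : R -> R)
    (x : R) (j : nat -> 'I_b) : R :=
  - limn (fun N => \sum_(0 <= n < N)
      gam lam b ^+ n.+1 *
      derive1 phi (x / b%:R ^+ n.+1 +
               \sum_(0 <= k < n.+1) (j k)%:R / b%:R ^+ (n.+1 - k))).

Definition Gam {R : realType} (lam : R) (b : nat) (phi : R -> R)
    (j : nat -> 'I_b) (x : R) : R :=
  if 0 <= x then
    (\int[lebesgue_measure]_(t in `[0, x]) Yfun lam b phi (t : R) j)
  else - (\int[lebesgue_measure]_(t in `[x, 0]) Yfun lam b phi (t : R) j).

Definition pij {R : realType} (lam : R) (b : nat) (phi : R -> R)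
    (j : nat -> 'I_b) (p : R * R) : R :=
  p.2 - Gam lam b phi j p.1.

Definition gmap {R : realType} (lam : R) (b : nat) (phi : R -> R)
    (i : 'I_b) (p : R * R) : R * R :=
  ((p.1 + i%:R) / b%:R, lam * p.2 + phi ((p.1 + i%:R) / b%:R)).

Definition gword {R : realType} (lam : R) (b : nat) (phi : R -> R)
    (w : seq 'I_b) : R * R -> R * R :=
  foldr (fun i f => gmap lam b phi i \o f) id w.

(* n-hat: the unique integer with lam^nhat <= b^-n < lam^(nhat-1)
   (it is a natural number since lam < 1) *)
Definition hat {R : realType} (lam : R) (b : nat) (n : nat) : nat :=
  xget 0%N [set k : nat | lam ^ (k%:Z) <= (b%:R : R) ^ (- (n%:Z)) < lam ^ (k%:Z - 1)].

Definition muW {R : realType} (lam : R) (b : nat) (phi : R -> R)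
    (A : set (R * R)) : R :=
  fine (lebesgue_measure ([set x : R | 0 <= x < 1] `&`
                          [set x | A (x, Wfun lam b phi x)])).

Definition push {S T : Type} {R : realType} (F : S -> T) (om : set S -> R)
    (A : set T) : R := om (F @^-1` A).

Definition Lint (R : realType) (b n : nat) (k : int) : set R :=
  [set x : R | k%:~R / b%:R ^+ n <= x < (k + 1)%:~R / b%:R ^+ n].

Definition Lcell {R : realType} (b n : nat) (x : R) : set R :=
  Lint R b n (Num.floor (b%:R ^+ n * x)).

Definition plogb {R : realType} (b : nat) (p : R) : R :=
  if p == 0 then 0 else p * (ln p / ln (b%:R)).

(* H(om_{x,i}, L_{i+m}) = - sum_{Q in L_{i+m}} om_{x,i}(Q) log_b om_{x,i}(Q),
   om_{x,i} = om( . /\ L_i(x)) / om(L_i(x)).  Only the b^m intervals Q of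
   L_{i+m} contained in L_i(x) can have positive om_{x,i}-mass (all others
   are disjoint from L_i(x) and contribute 0), so the sum runs over them. *)
Definition Hloc {R : realType} (b : nat) (om : set R -> R) (i m : nat) (x : R) : R :=
  - \sum_(r < b ^ m)
      plogb b (om (Lint R b (i + m)
                        (Num.floor (b%:R ^+ i * x) * (b ^ m)%:Z + r%:Z)
                   `&` Lcell b i x) / om (Lcell b i x)).

Definition entropy_porous {R : realType} (b : nat) (om : set R -> R)
    (h delta : R) (m n1 n2 : nat) : Prop :=
  ((n2.+1 - n1)%:R)^-1 *
    \sum_(n1 <= i < n2.+1)
      om [set x | 0 < om (Lcell b i x) /\
                  (m%:R)^-1 * Hloc b om i m x < h + delta]
  > 1 - delta.

Definition exact_dim {R : realType} (om : set R -> R) (a : R) : Prop :=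
  exists Nul : set R, [/\ measurable Nul, om Nul = 0 &
    forall y, ~ Nul y ->
      (fun r => ln (om (ball y r)) / ln r) @ 0^'+ --> a].

(* Main.v *)
Require Import Defs.
From HB Require Import structures.
From mathcomp Require Import all_boot all_order all_algebra.
From mathcomp Require Import all_classical all_reals all_analysis.
From mathcomp Require Import measurable_realfun lra ring zify.
Set Implicit Arguments.
Unset Strict Implicit.
Unset Printing Implicit Defensive.
Import Order.TTheory GRing.Theory Num.Theory.
Import numFieldNormedType.Exports.
Local Open Scope classical_set_scope.
Local Open Scope ring_scope.

(** On [0,1) the function x |-> pi_j(x, W(x)) is X_j = W - Gamma_j, and the
functional equation of W gives X_j((x+i)/b) = lam X_{ij}(x) + const.  Hence
pi_j g_u g_w mu is, up to an affine map, the law of X_J, where J is w reversed,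
followed by u reversed, followed by j.  When w is uniformly distributed so are
the first letters of J, and X_J depends on its tail only up to C gam^l; so the
almost sure exact dimensionality passes to most J, uniformly in the tail.

For such a J, Gibbs' inequality against the masses of balls bounds the entropy
of the law of X_J at level k+m by (k+m)(alpha+eps).  The law is also an average
of small copies of laws X_{wJ}, most of which lie in a single cell of level i
and are again alpha-dimensional, so the mean of the normalized local entropies
is at least alpha-eps at each level.  The local entropies telescope to the
total entropy, so they can exceed alpha+eps only on a small proportion of the
levels and cells. *)

(** * Lebesgue measure on [0,1) and the branches of x |-> b x mod 1 *)

(** The order of the quantifiers shapes the argument. [N] is fixed before t, j and u, so words have
    to be sorted into good and bad without knowing the tail of J: a word is bad as soon as one tail
    makes it bad. Exact dimensionality holds almost surely and without a rate; it becomes a bound on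
    averages over words because almost everywhere convergence implies convergence in measure. To
    this end the Bernoulli measure is modelled by Lebesgue measure on [0,1) through base-b digits,
    so that random words and small copies are handled by the same branches of x |-> b x mod 1.

    The obstacle to the lower bound is a small copy that straddles two cells. If alpha > 0, a
    typical X_J has little mass near any given point, hence few copies straddle once they are q
    letters finer than the cells; if alpha is below the error, nothing has to be proved. The q extra
    letters cost a constant factor in scale, which is negligible against b^m: this is what [M] is
    for. [K] makes the difference between k + m and k harmless, and [N] serves the finitely many
    levels up to k. *)

Section UnitInterval.
Context {R : realType}.
Implicit Types (A B : set R).
Notation mu := (@lebesgue_measure R).

(* [mu] is the outer measure, so [A] need not be measurable. *)
Definition prob A : R := fine (mu (`[0, 1[ `&` A)).

Lemma mu_unit : mu (`[0, 1[%classic : set R) = 1%E.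
Proof. by rewrite lebesgue_measure_itv/= lte_fin ltr01 oppr0 adde0. Qed.

Lemma mu_mono A B : A `<=` B -> (mu A <= mu B)%E.
Proof. exact: (@le_outer_measure _ _ (mu_ext (@wlength R idfun))). Qed.

Lemma probE A : mu (`[0, 1[ `&` A) = (prob A)%:E.
Proof.
rewrite /prob fineK// ge0_fin_numE; last exact: mu_ext_ge0.
apply: le_lt_trans (mu_mono (@subIsetl _ _ _)) _.
by rewrite mu_unit ltry.
Qed.

Lemma prob_ge0 A : 0 <= prob A.
Proof. by rewrite /prob fine_ge0//; exact: mu_ext_ge0. Qed.

Lemma probS A B : (forall x, 0 <= x < 1 -> A x -> B x) -> prob A <= prob B.
Proof.
move=> AB; rewrite -lee_fin -!probE; apply: mu_mono => x [/= x01 Ax]; split => //.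
by apply: AB; rewrite // in_itv/= in x01.
Qed.

Lemma eq_prob A B : (forall x, 0 <= x < 1 -> A x <-> B x) -> prob A = prob B.
Proof.
by move=> AB; apply/eqP; rewrite eq_le !probS// => x x01; rewrite AB.
Qed.

Lemma probT : prob setT = 1.
Proof. by rewrite /prob setIT mu_unit. Qed.

Lemma prob_le1 A : prob A <= 1.
Proof. by rewrite -probT; apply: probS. Qed.

Lemma prob0 : prob set0 = 0.
Proof. by rewrite /prob setI0 measure0. Qed.

Lemma prob_subadd A B : prob (A `|` B) <= prob A + prob B.
Proof.
rewrite -lee_fin EFinD -!probE setIUr.
exact: (@outer_measureU2 _ _ (mu_ext (@wlength R idfun))).
Qed.

Lemma probU A B : measurable A -> measurable B -> A `&` B = set0 ->
  prob (A `|` B) = prob A + prob B.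
Proof.
move=> mA mB AB; apply: EFin_inj; rewrite EFinD -!probE setIUr measureU//.
- exact: measurableI.
- exact: measurableI.
- by rewrite setIACA AB setI0.
Qed.

Lemma prob_bigcup_fin (n : nat) (F : nat -> set R) :
  (forall i, measurable (F i)) -> trivIset setT F ->
  prob (\big[setU/set0]_(i < n) F i) = \sum_(i < n) prob (F i).
Proof.
move=> mF tF; elim: n => [|n IH]; first by rewrite !big_ord0 prob0.
rewrite !big_ord_recr/= probU ?IH//; first exact: bigsetU_measurable.
rewrite big_distrl/= big1// => i _; apply/seteqP; split => // x [Fi Fn].
have := tF i n I I (ex_intro _ x (conj Fi Fn)).
by move=> e; have := ltn_ord i; rewrite e ltnn.
Qed.

Lemma prob_part (n : nat) (N : R -> nat) A :
  measurable A -> (forall s, measurable [set x | N x = s]) ->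
  (forall x, 0 <= x < 1 -> (N x < n)%N) ->
  prob A = \sum_(s < n) prob (A `&` [set x | N x = s]).
Proof.
move=> mA mN Nn.
rewrite -(@prob_bigcup_fin n (fun s => A `&` [set x | N x = s])).
- apply: eq_prob => x x01; rewrite -(bigcup_mkord n (fun s => A `&` [set x | N x = s])).
  split; first by move=> Ax; exists (N x) => //=; exact: Nn.
  by case=> s _ [].
- by move=> i; apply: measurableI.
- by move=> i j _ _ [x [[_ <-] [_ <-]]].
Qed.

Lemma prob_bigcup0 (F : nat -> set R) : (forall n, prob (F n) = 0) -> prob (\bigcup_n F n) = 0.
Proof.
move=> F0; apply: EFin_inj; rewrite -probE setI_bigcupr; apply/eqP.
rewrite eq_le; apply/andP; split; last exact: mu_ext_ge0.
apply: le_trans.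
  exact: (@outer_measure_sigma_subadditive _ _ (mu_ext (@wlength R idfun))).
by rewrite eseries0// => n _ _; rewrite [LHS]probE F0.
Qed.

(** Almost everywhere convergence implies convergence in measure: the limsup of the [F m] lies in
    the null set [N], and by continuity from above the measures of the tail unions tend to that of
    the limsup. *)
Lemma prob_limsup (F : nat -> set R) (N : set R) :
  (forall m, measurable (F m)) -> prob N = 0 ->
  (forall x, 0 <= x < 1 -> ~ N x -> exists M, forall m, (M <= m)%N -> ~ F m x) ->
  forall eta : R, 0 < eta -> exists M, forall m, (M <= m)%N -> prob (F m) <= eta.
Proof.
move=> mF N0 Nev eta eta0.
have mF1 m : measurable (`[0, 1[ `&` F m) by exact: measurableI.
have L0 : mu (lim_sup_set (fun m => `[0%R, 1%R[ `&` F m)) = 0%E.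
  apply/eqP; rewrite eq_le; apply/andP; split; last exact: mu_ext_ge0.
  apply: (@le_trans _ _ (prob N)%:E); last by rewrite N0.
  rewrite -probE; apply: mu_mono => x Lx.
  have x01 : x \in `[0, 1[ by case: (Lx 0%N I) => m _ [].
  split => //; apply: contrapT => /Nev; rewrite in_itv/= in x01 => /(_ x01)[M hM].
  by case: (Lx M I) => m /= Mm [_]; exact: hM.
have fin n : (mu (\bigcup_(k in [set k | (n <= k)%N]) (`[0%R, 1%R[ `&` F k)) < +oo)%E.
  apply: (@le_lt_trans _ _ 1%E); last by rewrite ltry.
  by rewrite -mu_unit; apply: mu_mono => x [k _ []].
have : mu (\bigcup_(k in [set k | (n <= k)%N]) (`[0%R, 1%R[ `&` F k)) @[n --> \oo] --> 0%E.
  rewrite -[X in _ --> X]L0; apply: lim_sup_set_cvg => //; exact: (fin 0%N).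
move=> /fine_cvgP[_ /cvgrPdist_lt/(_ _ eta0)[M _ hM]].
exists M => m Mm; have := hM _ Mm.
rewrite /= sub0r normrN ger0_norm ?fine_ge0 ?mu_ext_ge0// => /ltW; apply: le_trans.
rewrite -lee_fin -probE fineK; last by rewrite ge0_fin_numE ?mu_ext_ge0.
by apply: mu_mono => x [x01 Fx]; exists m => //=.
Qed.

Lemma measurable_affine (a c : R) : measurable_fun setT (fun x : R => a * x + c).
Proof. by apply: measurable_funD => //; exact: measurable_funM. Qed.

(** By uniqueness of Lebesgue measure it suffices to compare lengths of half-open intervals. *)
Lemma lebesgue_affine (a c : R) A : 0 < a -> measurable A ->
  mu ((fun x => a * x + c) @^-1` A) = (a^-1%:E * mu A)%E.
Proof.
move=> a0 mA.
pose f : R -> measurableTypeR R := fun x => a * x + c.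
have mf : measurable_fun setT f by exact: measurable_affine.
suff : mu A = mscale (NngNum (ltW a0)) (pushforward mu f) A.
  by move=> ->; rewrite /mscale/= muleA -EFinM mulVf ?gt_eqF// mul1e.
move=> m; apply: lebesgue_measure_unique => //= _ [[u v]] _ <-.
rewrite /mscale/= /pushforward.
have -> : f @^-1` `]u, v] = `](u - c) / a, (v - c) / a]%classic.
  apply/seteqP; split => x/=; rewrite /f !in_itv/= ltr_pdivrMr// ler_pdivlMr//;
  by rewrite ltrBlDr lerBrDr mulrC.
rewrite !lebesgue_measure_itv/= !lte_fin ltr_pM2r ?invr_gt0// ltrD2r.
case: ifPn => // _; last by rewrite mule0.
by rewrite -!EFinD -EFinM; congr (_%:E); field; rewrite gt_eqF.
Qed.

Section BaseB.
Context {b : nat} (b2 : (2 <= b)%N).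

Lemma b_gt0 : (0 < b%:R :> R).
Proof. by rewrite ltr0n (leq_trans _ b2). Qed.
#[local] Hint Resolve b_gt0 : core.

Definition branch (i : 'I_b) (x : R) : R := (x + i%:R) / b%:R.

Lemma branch01 (i : 'I_b) x : 0 <= x < 1 -> 0 <= branch i x < 1.
Proof.
move=> /andP[x0 x1]; rewrite /branch ler_pdivlMr// mul0r ltr_pdivrMr// mul1r.
rewrite addr_ge0//=; apply: (@lt_le_trans _ _ (1 + i%:R)); first by rewrite ltrD2r.
by rewrite addrC natr1 ler_nat.
Qed.

(** Invariance of Lebesgue measure under x |-> b x mod 1: the branch [i] maps [0,1) onto [i/b,
    (i+1)/b) with factor 1/b. *)
Lemma prob_branch A : measurable A ->
  prob A = b%:R^-1 * \sum_(i < b) prob [set x | A (branch i x)].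
Proof.
move=> mA.
have mI (i : nat) : measurable [set x : R | i%:R <= b%:R * x < i.+1%:R].
  rewrite (_ : [set x | _] = `[i%:R / b%:R, i.+1%:R / b%:R[%classic) //.
  by apply/seteqP; split => x/=; rewrite in_itv/= ler_pdivrMr// ltr_pdivlMr// mulrC.
rewrite -(@eq_prob (\big[setU/set0]_(i < b) (A `&` [set x : R | i%:R <= b%:R * x < i.+1%:R]))); last first.
  move=> x /andP[x0 x1].
  rewrite -(bigcup_mkord b (fun s : nat => A `&` [set x : R | s%:R <= b%:R * x < s.+1%:R])).
  split; first by case=> s _ [].
  move=> Ax; exists (Num.truncn (b%:R * x)) => /=; last first.
    by split => //=; apply: truncn_itv; rewrite mulr_ge0.
  rewrite truncn_lt_nat ?mulr_ge0//.
  by rewrite gtr_pMr.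
rewrite (@prob_bigcup_fin b (fun i : nat => A `&` [set x : R | i%:R <= b%:R * x < i.+1%:R])); last 2 first.
  by move=> i; exact: measurableI.
  move=> i j _ _ [x [[_ /= /andP[ix xi]] [_ /= /andP[jx xj]]]].
  have := le_lt_trans ix xj; have := le_lt_trans jx xi; rewrite !ltr_nat !ltnS.
  by move=> ? ?; apply/eqP; rewrite eqn_leq; apply/andP.
rewrite mulr_sumr; apply: eq_bigr => i _.
apply: EFin_inj; rewrite EFinM -!probE.
have -> : `[0%R, 1%R[ `&` [set x | A (branch i x)] =
   (fun x : R => b%:R^-1 * x + i%:R / b%:R) @^-1` (A `&` [set x : R | i%:R <= b%:R * x < i.+1%:R]).
  have E (x : R) : b%:R^-1 * x + i%:R / b%:R = branch i x.
    by rewrite /branch mulrDl; congr (_ + _); rewrite mulrC.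
  have F (x : R) : b%:R * branch i x = x + i%:R.
    by rewrite /branch mulrC divfK// gt_eqF.
  have G (x : R) : (0 <= x < 1) = (i%:R <= b%:R * branch i x < i.+1%:R).
    by rewrite F lerDr -natr1 [_%:R + 1]addrC ltrD2r.
  by apply/seteqP; split => x/=; rewrite in_itv/= E G => -[].
rewrite lebesgue_affine ?invr_gt0//; last exact: measurableI.
rewrite invrK muleA -EFinM mulVf ?gt_eqF// mul1e; congr (mu _).
have H (x : R) : i%:R <= b%:R * x < i.+1%:R -> 0 <= x < 1.
  move=> /andP[u v]; rewrite -(pmulr_rge0 _ b_gt0) (le_trans _ u)//=.
  by rewrite -(ltr_pM2l b_gt0) mulr1 (lt_le_trans v)// ler_nat.
by apply/seteqP; split => [x [_ []]//|x [Ax xi]]; split => //=; rewrite in_itv/=; exact: H.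
Qed.

End BaseB.

End UnitInterval.

(** * Words, uniform averages and the Bernoulli measure *)

Section Averages.
Context {R : realType} {b : nat}.
Implicit Types (f g : seq 'I_b -> R) (w u v : seq 'I_b).

Definition ind (P : Prop) : R := (`[< P >] : nat)%:R.

Lemma ind_ge0 P : 0 <= ind P.
Proof. by rewrite /ind ler0n. Qed.

Lemma ind_le1 P : ind P <= 1.
Proof. by rewrite /ind; case: asboolP. Qed.

Lemma ind1 P : P -> ind P = 1.
Proof. by move=> p; rewrite /ind asboolT. Qed.

Lemma ind0 P : ~ P -> ind P = 0.
Proof. by move=> p; rewrite /ind asboolF. Qed.

Lemma ind_mono (P Q : Prop) : (P -> Q) -> ind P <= ind Q.
Proof.
by move=> PQ; have [/PQ q|np] := pselect P; [rewrite (ind1 q) ind_le1|rewrite ind0 ?ind_ge0].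
Qed.

Lemma ind_or (P Q : Prop) : ind (P \/ Q) <= ind P + ind Q.
Proof.
have [p|np] := pselect P; first by rewrite (ind1 p) (le_trans (ind_le1 _))// lerDl ind_ge0.
by rewrite (ind0 np) add0r; apply: ind_mono => -[].
Qed.

(** Expectation over a uniform word of length [n], written as an iterated mean so that peeling off a
    letter matches [prob_branch]. *)
Fixpoint avg (n : nat) f : R :=
  if n is n'.+1 then b%:R^-1 * \sum_(i < b) avg n' (fun w => f (i :: w)) else f [::].

Lemma eq_avg n f g : (forall w, size w = n -> f w = g w) -> avg n f = avg n g.
Proof.
elim: n f g => [|n IH] f g fg /=; first exact: fg.
by congr (_ * _); apply: eq_bigr => i _; apply: IH => w wn; apply: fg; rewrite /= wn.
Qed.

Lemma avg_le n f g : (forall w, size w = n -> f w <= g w) -> avg n f <= avg n g.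
Proof.
elim: n f g => [|n IH] f g fg /=; first exact: fg.
rewrite ler_wpM2l ?invr_ge0//; apply: ler_sum => i _; apply: IH => w wn.
by apply: fg; rewrite /= wn.
Qed.

Lemma avgD n f g : avg n (fun w => f w + g w) = avg n f + avg n g.
Proof.
elim: n f g => [|n IH] f g //=; rewrite -mulrDr -big_split/=.
by congr (_ * _); apply: eq_bigr => i _; exact: IH.
Qed.

Lemma avgZ n c f : avg n (fun w => c * f w) = c * avg n f.
Proof.
elim: n f => [|n IH] f //=; rewrite mulrCA; congr (_ * _); rewrite mulr_sumr.
by apply: eq_bigr => i _; exact: IH.
Qed.

Lemma avg_cat n m f : avg (n + m) f = avg n (fun u => avg m (fun w => f (u ++ w))).
Proof.
elim: n f => [|n IH] f //=.
by congr (_ * _); apply: eq_bigr => i _; exact: IH.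
Qed.

Lemma avg0 n : avg n (fun=> 0) = 0.
Proof. by elim: n => [|n IH] //=; rewrite IH big1 ?mulr0. Qed.

Lemma avg_sum n (I : Type) (r : seq I) (P : pred I) (F : I -> seq 'I_b -> R) :
  avg n (fun w => \sum_(i <- r | P i) F i w) = \sum_(i <- r | P i) avg n (F i).
Proof.
elim: r => [|a r IH].
  by rewrite big_nil -[RHS](avg0 n); apply: eq_avg => w _; rewrite big_nil.
rewrite big_cons; case: ifPn => Pa; last first.
  by rewrite -IH; apply: eq_avg => w _; rewrite big_cons (negbTE Pa).
by rewrite -IH -avgD; apply: eq_avg => w _; rewrite big_cons Pa.
Qed.

Lemma avg_exch n m (F : seq 'I_b -> seq 'I_b -> R) :
  avg n (fun u => avg m (F u)) = avg m (fun w => avg n (F^~ w)).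
Proof.
elim: n F => [|n IH] F //=.
rewrite avgZ avg_sum; congr (_ * _); apply: eq_bigr => i _; exact: IH.
Qed.

Lemma avg_rcons n f :
  avg n.+1 f = b%:R^-1 * \sum_(i < b) avg n (fun w => f (rcons w i)).
Proof.
rewrite -addn1 avg_cat /= avgZ avg_sum; congr (_ * _); apply: eq_bigr => i _.
by apply: eq_avg => w _; rewrite cats1.
Qed.

(** Needed because in [gword] the last letter acts first, so that J begins with the reversal of the
    random word. *)
Lemma avg_rev n f : avg n (fun w => f (rev w)) = avg n f.
Proof.
elim: n f => [|n IH] f //; rewrite avg_rcons [RHS]/=; congr (_ * _).
apply: eq_bigr => i _; rewrite -IH; apply: eq_avg => w _.
by rewrite rev_rcons revK.
Qed.

Hypothesis b2 : (2 <= b)%N.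

Lemma avg_cst n c : avg n (fun=> c) = c.
Proof.
elim: n => [|n IH] //=; rewrite IH sumr_const card_ord -[c *+ b]mulr_natl mulKf//.
by rewrite gt_eqF// ltr0n (leq_trans _ b2).
Qed.

Lemma avg_ge0 n f : (forall w, size w = n -> 0 <= f w) -> 0 <= avg n f.
Proof. by move=> f0; rewrite -[leLHS](avg_cst n); exact: avg_le. Qed.

Lemma avg_markov n f eta : 0 < eta -> (forall w, size w = n -> 0 <= f w) ->
  avg n (fun w => ind (eta < f w)) <= eta^-1 * avg n f.
Proof.
move=> eta0 f0; rewrite -avgZ; apply: avg_le => w wn.
have [lt|/negP] := pselect (eta < f w).
  by rewrite (ind1 lt) mulrC ler_pdivlMr// mul1r ltW.
rewrite -leNgt => le; rewrite ind0; last by apply/negP; rewrite -leNgt.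
by rewrite mulr_ge0 ?f0 ?invr_ge0 ?ltW.
Qed.

Lemma avg_eq w : avg (size w) (fun v => ind (v = w)) = b%:R ^- size w.
Proof.
elim: w => [|a w IH] /=; first by rewrite ind1// expr0 invr1.
rewrite (bigD1 a)//= big1 ?addr0.
  rewrite exprS invfM; congr (_ * _); rewrite -IH; apply: eq_avg => v _.
  by congr ind; apply/propext; split => [[]|->].
move=> i ia; rewrite -[RHS](avg0 (size w)); apply: eq_avg => v _.
by rewrite ind0// => -[/eqP]; rewrite (negbTE ia).
Qed.

End Averages.

Section Words.
Context {R : realType} {b : nat} (b2 : (2 <= b)%N).
Implicit Types (w u v : seq 'I_b) (j z : nat -> 'I_b).
Let bpos : (0 < b)%N. Proof. exact: leq_trans b2. Qed.

(* The first letter acts first, whereas in [gword] the last one does. *)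
Fixpoint Hw w (x : R) : R := if w is i :: u then Hw u (branch i x) else x.

Lemma Hw_cat u w x : Hw (u ++ w) x = Hw w (Hw u x).
Proof. by elim: u x => //= i u IH x; rewrite IH. Qed.

Lemma Hw01 w x : 0 <= x < 1 -> 0 <= Hw w x < 1.
Proof. by elim: w x => //= i u IH x x01; apply/IH/branch01. Qed.

Lemma measurable_branch (i : 'I_b) : measurable_fun setT (branch i : R -> R).
Proof.
rewrite (_ : branch i = (fun x : R => b%:R^-1 * x + i%:R / b%:R)); first exact: measurable_affine.
by apply/funext => x; rewrite /branch mulrDl; congr (_ + _); rewrite mulrC.
Qed.

Lemma measurable_Hw w : measurable_fun setT (Hw w : R -> R).
Proof.
elim: w => [|i u IH] /=; first exact: measurable_id.
by apply: measurableT_comp => //; exact: measurable_branch.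
Qed.

Lemma measurable_preim (f : R -> R) (A : set R) : measurable_fun setT f -> measurable A ->
  measurable [set x | A (f x)].
Proof. by move=> mf mA; rewrite -[X in measurable X]setTI; exact: mf. Qed.

Lemma prob_avg n A : measurable A -> prob A = avg n (fun w => prob [set x | A (Hw w x)]).
Proof.
elim: n => [|n IH] mA //; rewrite IH// -addn1 addnC avg_cat /= -avg_sum -avgZ.
apply: eq_avg => w _; rewrite (prob_branch b2)//.
by apply: measurable_preim => //; exact: measurable_Hw.
Qed.

(** The word [w] followed by the sequence [j]; the default of [nth] is never read. *)
Definition scat w j : nat -> 'I_b :=
  fun k => if (k < size w)%N then nth (j 0%N) w k else j (k - size w)%N.

Lemma scat_nil j : scat [::] j = j.
Proof. by apply/funext => k; rewrite /scat subn0. Qed.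

Lemma scat_cat u w j : scat (u ++ w) j = scat u (scat w j).
Proof.
apply/funext => k; rewrite /scat size_cat nth_cat.
case: (ltnP k (size u)) => ku.
  rewrite (leq_trans ku (leq_addr _ _)); exact: set_nth_default.
by rewrite -ltn_subLR// subnDA; case: ifP => // kw; exact: set_nth_default.
Qed.

Lemma scat_cons i w j : scat (i :: w) j = scat [:: i] (scat w j).
Proof. by rewrite -scat_cat. Qed.

Lemma scat_mkseq n j : scat (mkseq j n) (fun k => j (k + n)%N) = j.
Proof.
apply/funext => k; rewrite /scat size_mkseq; case: ltnP => kn.
  by rewrite nth_mkseq.
by rewrite subnK.
Qed.

Lemma cylP w j : cyl w j <-> mkseq j (size w) = w.
Proof.
split => [cw|e k kw].
  apply: (@eq_from_nth _ (j 0%N)); rewrite size_mkseq// => k kw.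
  by rewrite nth_mkseq// cw//; exact: set_nth_default.
by rewrite -[in RHS]e nth_mkseq.
Qed.

(** Base-b digits. They carry Lebesgue measure on [0,1) to the uniform Bernoulli measure, which is
    how the latter is handled throughout. *)
Definition dig (x : R) : nat -> 'I_b :=
  fun k => Ordinal (ltn_pmod (Num.truncn (b%:R ^+ k.+1 * x)) bpos).

Lemma truncnD (x : R) (n : nat) : 0 <= x -> Num.truncn (x + n%:R) = (Num.truncn x + n)%N.
Proof.
move=> x0; apply/eqP; rewrite truncn_eq ?addr_ge0//; have /andP[u v] := truncn_itv x0.
by rewrite natrD lerD2r u/= -addSn natrD ltrD2r.
Qed.

Lemma dig_branch (i : 'I_b) x : 0 <= x < 1 -> dig (branch i x) = scat [:: i] (dig x).
Proof.
move=> /andP[x0 x1]; apply/funext => k; apply: val_inj; rewrite /= /scat/=.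
have F : b%:R * branch i x = x + i%:R.
  by rewrite /branch mulrC divfK// gt_eqF// ltr0n.
rewrite exprSr -mulrA F; case: k => [|k] /=.
  rewrite expr0 mul1r truncnD//; rewrite (_ : Num.truncn x = 0%N) ?add0n ?modn_small//.
  by apply/eqP; rewrite truncn_eq// x0 x1.
rewrite subn1/= mulrDr -natrX -natrM truncnD ?mulr_ge0//.
by rewrite natrX expnS -mulnA addnC mulnC modnMDl.
Qed.

Lemma measurable_truncn (S : set nat) (f : R -> R) : measurable_fun setT f ->
  measurable [set x | S (Num.truncn (f x))].
Proof.
move=> mf; rewrite (_ : [set x | _] = \bigcup_(n in S) [set x | Num.truncn (f x) = n]); last first.
  by apply/seteqP; split => x /=; [move=> Sx; exists (Num.truncn (f x))|case=> n Sn /= ->].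
apply: bigcup_measurable => n _.
apply: (@measurable_preim f [set y | Num.truncn y = n]) => //.
case: n => [|n].
  rewrite (_ : [set y : R | Num.truncn y = 0%N] = [set` `]-oo, 1[]) //.
  by apply/seteqP; split => x /=; rewrite in_itv/= ltNge => /truncn0Pn.
rewrite (_ : [set y : R | Num.truncn y = n.+1] = [set` `[n.+1%:R, n.+2%:R[]) //.
apply/seteqP; split => x /=; rewrite in_itv/=.
  move=> e; rewrite -e; apply: truncn_itv.
  rewrite leNgt; apply/negP => x0; move: e; rewrite (_ : Num.truncn x = 0%N)//.
  by apply/truncn0Pn; rewrite -ltNge (lt_trans x0).
by move=> h; apply/eqP; rewrite truncn_eq// (le_trans _ (andP h).1).
Qed.

Lemma measurable_dig n (S : set (seq 'I_b)) : measurable [set x : R | S (mkseq (dig x) n)].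
Proof.
elim: n S => [|n IH] S.
  have [s|ns] := pselect (S [::]).
    by rewrite (_ : [set x | _] = setT)//; apply/seteqP; split.
  by rewrite (_ : [set x | _] = set0)//; apply/seteqP; split.
rewrite (_ : [set x | _] = \bigcup_(i in [set: 'I_b])
   ([set x | S (rcons (mkseq (dig x) n) i)] `&`
    [set x : R | (fun t => (t %% b = i)%N) (Num.truncn (b%:R ^+ n.+1 * x))])).
  apply: fin_bigcup_measurable => // i _; apply: measurableI; first exact: (IH (fun w => S (rcons w i))).
  apply: (@measurable_truncn (fun t => (t %% b = i)%N) (fun x => b%:R ^+ n.+1 * x)).
  exact: mulrl_measurable.
have E (x : R) : mkseq (dig x) n.+1 = rcons (mkseq (dig x) n) (dig x n).
  by rewrite /mkseq -addn1 iotaD map_cat cats1.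
apply/seteqP; split => x /=; rewrite E; first by move=> Sx; exists (dig x n).
by case=> i _ [/= Si e]; rewrite (_ : dig x n = i)//; exact: val_inj.
Qed.

Lemma prob_dig n (S : set (seq 'I_b)) :
  prob [set x : R | S (mkseq (dig x) n)] = avg n (fun w => ind (S w)).
Proof.
elim: n S => [|n IH] S.
  rewrite /=; have [s|ns] := pselect (S [::]).
    by rewrite ind1// -probT; apply: eq_prob.
  by rewrite ind0// -prob0; apply: eq_prob.
rewrite (prob_branch b2); last exact: measurable_dig.
rewrite [RHS]/=; congr (_ * _); apply: eq_bigr => i _.
rewrite -(IH (fun w => S (i :: w))); apply: eq_prob => x x01.
rewrite /= dig_branch//.
suff -> : mkseq (scat [:: i] (dig x)) n.+1 = i :: mkseq (dig x) n by [].
rewrite /mkseq/= -[1%N]addn0 iotaDl -map_comp; congr (_ :: _).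
by apply: eq_map => k; rewrite /= /scat/= subn1.
Qed.

Lemma prob_cyl w : prob [set x : R | cyl w (dig x)] = b%:R ^- size w.
Proof.
rewrite -avg_eq -(prob_dig _ (fun v => v = w)).
by apply: eq_prob => x _; rewrite /= cylP.
Qed.

(** A cover of [A] by cylinders pulls back to a cover by sets of Lebesgue measure b^-|c n|. This one
    inequality serves both ends: it carries null sets of sequences to null sets of points, and it
    bounds the measure in the conclusion from below. *)
Lemma nu_outer_ge (A : set (nat -> 'I_b)) :
  ((prob [set x : R | A (dig x)])%:E <= nu_outer R b A)%E.
Proof.
apply: le_ereal_inf_tmp => _ [c [Ac ->]]; rewrite -probE.
apply: (@le_trans _ _ (lebesgue_measure (\bigcup_n (`[0%R, 1%R[ `&` [set x : R | cyl (c n) (dig x)])))).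
  by apply: mu_mono => x [x01 /Ac[n _ cn]]; exists n.
apply: le_trans.
  exact: (@outer_measure_sigma_subadditive _ _ (mu_ext (@wlength R idfun))).
by apply: lee_nneseries => // n _; rewrite [leLHS]probE prob_cyl.
Qed.

Lemma nu_outer_avg n (S : set (seq 'I_b)) :
  ((avg n (fun w => ind (S w)))%:E <= nu_outer R b [set j | S (mkseq j n)])%E.
Proof. by rewrite -prob_dig; exact: nu_outer_ge. Qed.

(** From almost every sequence to most words, uniformly in the tail. The event that some
    continuation of the first [l m] digits lies in [B' m] depends on finitely many digits, hence is
    measurable, and it still forces [B m] for the actual sequence; [prob_limsup] applies to it. *)
Lemma eventually_avg (B B' : nat -> set (nat -> 'I_b)) (l : nat -> nat) (N : set (nat -> 'I_b)) :
  (forall m j j', (forall k, (k < l m)%N -> j k = j' k) -> B' m j' -> B m j) ->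
  nu_outer R b N = 0%E ->
  (forall j, ~ N j -> exists M, forall m, (M <= m)%N -> ~ B m j) ->
  forall eta : R, 0 < eta -> exists M, forall m, (M <= m)%N -> forall n, (l m <= n)%N ->
    avg n (fun w => ind (exists z, B' m (scat w z))) <= eta.
Proof.
move=> BB' N0 Nev eta eta0.
pose F m := [set x : R | (fun w => exists z, B' m (scat w z)) (mkseq (dig x) (l m))].
have mF m : measurable (F m) by exact: measurable_dig.
have [||M hM] := @prob_limsup R F [set x | N (dig x)] mF _ _ eta eta0.
- apply/eqP; rewrite eq_le prob_ge0 andbT -lee_fin; apply: le_trans (nu_outer_ge N) _.
  by rewrite N0.
- move=> x _ /Nev[M hM]; exists M => m Mm [z Bz]; apply: (hM m Mm).
  by apply: BB' Bz => k kl; rewrite /scat size_mkseq kl nth_mkseq.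
exists M => m Mm n ln; apply: le_trans (hM m Mm).
rewrite -(prob_dig n (fun w => exists z, B' m (scat w z))).
apply: probS => x _ [z Bz].
(* The word of length [n] is cut after [l m] letters; its other letters join the tail. *)
exists (fun k => scat (mkseq (dig x) n) z (k + l m)%N).
suff -> : mkseq (dig x) (l m) = mkseq (scat (mkseq (dig x) n) z) (l m) by rewrite scat_mkseq.
apply: (@eq_from_nth _ (z 0%N)); rewrite !size_mkseq// => k kl.
by rewrite !nth_mkseq// /scat size_mkseq (leq_trans kl ln) nth_mkseq// (leq_trans kl).
Qed.

End Words.

(** * Exact dimensionality and masses of balls *)

Section BallMass.
Context {R : realType}.
Implicit Types (f g : R -> R) (A : set R).

Definition law f A : R := prob [set x | A (f x)].

Definition bmass f (x r : R) : R := prob [set y | `|f x - f y| < r].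

Lemma bmass_le f g x r s :
  (forall y, 0 <= y < 1 -> `|f x - f y| < r -> `|g x - g y| < s) ->
  bmass f x r <= bmass g x s.
Proof. by move=> h; exact: probS. Qed.

Lemma measurable_lt_set f r : measurable_fun setT f -> measurable [set y | f y < r].
Proof.
move=> mf; rewrite (_ : [set y | _] = [set y | [set` `]-oo, r[] (f y)]).
  exact: measurable_preim.
by apply/seteqP; split => x /=; rewrite in_itv.
Qed.

Lemma measurable_gt_set f r : measurable_fun setT f -> measurable [set y | r < f y].
Proof.
move=> mf; rewrite (_ : [set y | _] = [set y | [set` `]r, +oo[] (f y)]).
  exact: measurable_preim.
by apply/seteqP; split => x /=; rewrite in_itv/= andbT.
Qed.

(** The mass of a ball is the measure of a section of a measurable subset of the plane. *)
Lemma measurable_bmass f r : measurable_fun setT f -> measurable_fun setT (bmass f ^~ r).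
Proof.
move=> mf.
pose A : set (R * R) := (setT `*` `[0, 1[%classic) `&` [set p | `|f p.1 - f p.2| < r].
have mA : measurable A.
  apply: measurableI; first exact: measurableX.
  have mg : measurable_fun setT (fun p : R * R => `|f p.1 - f p.2|).
    apply: measurableT_comp => //; apply: measurable_funB.
      by apply: measurableT_comp.
    by apply: measurableT_comp.
  rewrite (_ : [set p | _] = setT `&` (fun p : R * R => `|f p.1 - f p.2|) @^-1` [set` `]-oo, r[]).
    exact: mg.
  by rewrite setTI; apply/seteqP; split => x /=; rewrite in_itv.
have := measurable_fun_xsection (@lebesgue_measure R) mA.
rewrite (_ : _ \o _ = EFin \o (bmass f ^~ r)); first by move/measurable_EFinP.
apply/funext => x /=; rewrite /bmass -probE; congr lebesgue_measure.
by apply/seteqP; split => y; rewrite /xsection /= inE /A /=; tauto.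
Qed.

(** Where a ball has mass 0, the convention [ln 0 = 0] makes the quotient in [exact_dim]
    meaningless, so these points are removed separately. The range of [f] is cut into finitely many
    intervals of length [r]; one that contains such a value lies in its ball, of mass 0. *)
Lemma bmass0_null f (r C : R) : measurable_fun setT f -> 0 < r ->
  (forall x : R, 0 <= x < 1 -> `|f x| <= C) -> prob [set x | bmass f x r = 0] = 0.
Proof.
move=> mf r0 fC.
have C0 : 0 <= C by apply: le_trans (fC 0 _); rewrite // lexx ltr01.
pose N x := Num.truncn ((f x + C) / r).
have mN s : measurable [set x | N x = s].
  apply: (@measurable_truncn R (fun n => n = s) (fun x => (f x + C) / r)).
  by apply: measurable_funM => //; exact: measurable_funD.
have fC0 x : 0 <= x < 1 -> 0 <= (f x + C) / r.
  move=> /fC; rewrite ler_norml => /andP[+ _] => h.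
  by rewrite divr_ge0// ?(ltW r0)// -lerBlDr sub0r.
have mZ : measurable [set x | bmass f x r = 0].
  exact: (measurable_preim (measurable_bmass r mf) (measurable_set1 0)).
rewrite (@prob_part _ (Num.truncn ((C + C) / r)).+1 N)//; last first.
  move=> x x01; rewrite ltnS; apply: le_truncn; rewrite ler_pM2r ?invr_gt0// lerD2r.
  by have := fC x x01; rewrite ler_norml => /andP[].
rewrite big1// => s _.
have [[x [x01 [/= bx Nx]]]|nx] := pselect (exists x, 0 <= x < 1 /\ [set x | bmass f x r = 0] x /\ N x = s); last first.
  rewrite -[RHS](@prob0 R); apply: eq_prob => x x01; split => // -[bx Nx].
  by case: nx; exists x; split => //; split.
apply/eqP; rewrite eq_le prob_ge0 andbT -bx; apply: probS => y y01 [_ /= Ny].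
have /andP[] := truncn_itv (fC0 x x01); have /andP[] := truncn_itv (fC0 y y01).
rewrite -/(N x) -/(N y) Ny Nx ler_pdivlMr// ltr_pdivrMr// ler_pdivlMr// ltr_pdivrMr//.
rewrite -natr1 ltr_norml => *; apply/andP; split; lra.
Qed.

(* A point is atypical at scale r when the mass of its r-ball is not
   between r^(al + d) and r^(al - d). *)
Definition lowmass f (al d r : R) x := bmass f x r < expR ((al + d) * ln r).
Definition highmass f (al d r : R) x := expR ((al - d) * ln r) < bmass f x r.

Lemma exact_dim_atypical f (al C : R) : measurable_fun setT f ->
  (forall x : R, 0 <= x < 1 -> `|f x| <= C) ->
  exact_dim (law f) al ->
  forall r : nat -> R, (forall m, 0 < r m) -> r @ \oo --> 0 ->
  forall d eta : R, 0 < d -> 0 < eta -> exists M, forall m, (M <= m)%N ->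
    prob [set x | lowmass f al d (r m) x \/ highmass f al d (r m) x] <= eta.
Proof.
move=> mf fC [Nul [mN N0 Ncv]] r r0 rcv d eta d0 eta0.
pose Z m := [set x | bmass f x (r m) = 0].
apply: (@prob_limsup _ _ ([set x | Nul (f x)] `|` \bigcup_m Z m)) => //.
- move=> m; rewrite (_ : [set x | _] =
    [set x | bmass f x (r m) < expR ((al + d) * ln (r m))] `|`
    [set x | expR ((al - d) * ln (r m)) < bmass f x (r m)])//.
  apply: measurableU; [apply: measurable_lt_set|apply: measurable_gt_set];
  exact: measurable_bmass.
- apply/eqP; rewrite eq_le prob_ge0 andbT; apply: le_trans (prob_subadd _ _) _.
  rewrite prob_bigcup0; last by move=> m; exact: bmass0_null fC.
  by rewrite addr0; move: N0; rewrite /law => ->.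
move=> x x01 /not_orP[nN nZ].
have bpos m : 0 < bmass f x (r m).
  rewrite lt_neqAle prob_ge0 andbT eq_sym; apply/eqP => b0; apply: nZ.
  by exists m.
have /(_ r (conj r0 rcv)) := (cvg_at_rightP _ _ _).1 (Ncv _ nN).
move=> /cvgrPdist_lt/(_ _ d0)[M1 _ h1].
move/cvgrPdist_lt : rcv => /(_ _ (@ltr01 R))[M2 _ h2].
exists (maxn M1 M2) => m; rewrite geq_max => /andP[m1 m2].
have := h1 _ m1; have := h2 _ m2 => /=; rewrite sub0r normrN gtr0_norm// => rm1.
have lr : ln (r m) < 0 by apply: ln_lt0; rewrite r0 rm1.
have -> : law f (ball (f x) (r m)) = bmass f x (r m).
  by [].
rewrite ltr_distl => /andP[u v].
have eb : bmass f x (r m) = expR (ln (bmass f x (r m))) by rewrite lnK ?posrE.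
rewrite /lowmass /highmass eb !ltr_expR.
(* [ln (r m)] is negative, so clearing it from the quotient reverses both inequalities. *)
move: u; rewrite ltrBlDr ltr_ndivrMr// => u.
move: v; rewrite -ltrBlDr ltr_ndivlMr// => v.
case; lra.
Qed.

End BallMass.

(** * Entropies of b-adic cells *)

Section Gibbs.
Context {R : realType}.

(** From ln y <= y - 1 at y = q/p. The weights [q] are not normalized, only their total is bounded
    by that of [p]. *)
Lemma gibbs (I : finType) (p q : I -> R) :
  (forall i, 0 <= p i) -> (forall i, 0 <= q i) -> (forall i, 0 < p i -> 0 < q i) ->
  \sum_i q i <= \sum_i p i -> \sum_i p i * ln (q i) <= \sum_i p i * ln (p i).
Proof.
move=> p0 q0 pq Sqp; rewrite -subr_le0 -sumrB.
apply: (@le_trans _ _ (\sum_i (q i - p i))); last by rewrite sumrB subr_le0.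
apply: ler_sum => i _; have [pi0|] := eqVneq (p i) 0.
  by rewrite pi0 !mul0r !subr0.
rewrite neq_lt ltNge p0/= => pi0; have qi0 := pq _ pi0.
rewrite -mulrBr -ln_div ?posrE//.
have : ln (1 + (q i / p i - 1)) <= q i / p i - 1.
  by apply: le_ln1Dx; rewrite ltrBDr addNr divr_gt0.
rewrite addrC subrK => h; apply: le_trans (ler_wpM2l (p0 i) h) _.
by rewrite mulrBr mulr1 mulrC divfK// gt_eqF.
Qed.

Lemma xlnx_le0 (p : R) : 0 <= p <= 1 -> p * ln p <= 0.
Proof. by move=> /andP[p0 p1]; rewrite mulr_ge0_le0// ln_le0. Qed.

End Gibbs.

Lemma big_split_index {R : nmodType} (n k : nat) (F : nat -> R) :
  \sum_(s < n * k) F s = \sum_(s < n) \sum_(r < k) F (s * k + r)%N.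
Proof.
elim: n => [|n IH]; first by rewrite !big_ord0.
rewrite big_ord_recr/= -IH -!(big_mkord xpredT).
rewrite (@big_cat_nat _ _ _ (n * k)%N _ (n.+1 * k)%N)//=; last by rewrite leq_mul2r leqnSn orbT.
congr (_ + _); rewrite -{1}[(n * k)%N]add0n big_addn mulSn addnK.
by rewrite big_mkord; apply: eq_bigr => r _; rewrite addnC.
Qed.

Lemma telescope_shift {R : zmodType} (u : nat -> R) k m :
  \sum_(1 <= i < k.+1) (u (i + m)%N - u i) = \sum_(a < m) (u (k + a).+1 - u a.+1).
Proof.
elim: m => [|m IH].
  by rewrite big_ord0 big1// => i _; rewrite addn0 subrr.
have /= E := @telescope_sumr _ 1 k.+1 (fun i => u (i + m)%N) isT.
rewrite add1n addSn in E; rewrite big_ord_recr/= -IH -E.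
by rewrite -big_split/=; apply: eq_bigr => i _; rewrite addnS addrC addrA subrK.
Qed.

Definition nearby (A s t : nat) : bool := (t <= s + A)%N && (s <= t + A)%N.

Lemma nearby_count (A N t : nat) : (\sum_(s < N) nearby A s t <= A.*2.+1)%N.
Proof.
(* The number of integers common to [t - A, t + A] and [0, N), a bound that the induction on [N] can
   carry. *)
suff : (\sum_(s < N) nearby A s t <= minn N (t + A + 1) - (t - A))%N by lia.
elim: N => [|N IH]; first by rewrite big_ord0.
rewrite big_ord_recr/=; move: IH; set S := (\sum_(_ < _) _)%N; rewrite /nearby.
by case: (leqP t (N + A)); case: (leqP N (t + A)) => /=; lia.
Qed.

Lemma avg_eq0 {R : realType} {b : nat} (n : nat) (f : seq 'I_b -> R) : (2 <= b)%N ->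
  (forall w, size w = n -> 0 <= f w) -> avg n f = 0 -> forall w, size w = n -> f w = 0.
Proof.
move=> b2; elim: n f => [|n IH] f f0 /=; first by move=> f00 [].
have binv : (b%:R^-1 : R) != 0 by rewrite invr_eq0 pnatr_eq0 -lt0n ltnW.
move/eqP; rewrite mulf_eq0 (negbTE binv)/= psumr_eq0; last first.
  by move=> i _; apply: avg_ge0 => // w wn; apply: f0; rewrite /= wn.
move=> /allP h [//|i w] /= [wn].
have /eqP hi := h i (mem_index_enum _).
by apply: (IH (fun w => f (i :: w))) => // v vn; apply: f0; rewrite /= vn.
Qed.

Section Cells.
Context {R : realType} {b : nat} (b2 : (2 <= b)%N).
Implicit Types (G : R -> R).
Let bpos : (0 < b)%N. Proof. exact: leq_trans b2. Qed.

Definition cell G (i : nat) (x : R) : nat := Num.truncn (b%:R ^+ i * G x).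

Definition pc G (i s : nat) : R := prob [set x | cell G i x = s].

(** In natural logarithms; ln b is divided out later. The values of [G] are meant to lie in [0, B),
    which gives [B * b ^ i] cells. *)
Definition ent G (B i : nat) : R := - \sum_(s < B * b ^ i) pc G i s * ln (pc G i s).

Definition Hl G (i m s : nat) : R :=
  - \sum_(r < b ^ m) (pc G (i + m) (s * b ^ m + r) / pc G i s) *
                     ln (pc G (i + m) (s * b ^ m + r) / pc G i s).

Lemma truncn_div (x : R) (n : nat) : 0 <= x -> (0 < n)%N ->
  Num.truncn (x / n%:R) = (Num.truncn x %/ n)%N.
Proof.
move=> x0 n0; have n0' : (0 < n%:R :> R) by rewrite ltr0n.
apply/eqP; rewrite truncn_eq ?divr_ge0//; have /andP[u v] := truncn_itv x0.
rewrite ler_pdivlMr// ltr_pdivrMr// -!natrM (le_trans _ u) ?ler_nat ?leq_divM//=.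
by apply: (lt_le_trans v); rewrite ler_nat ltn_ceil.
Qed.

Lemma cell_div G i m x : 0 <= G x -> cell G i x = (cell G (i + m) x %/ b ^ m)%N.
Proof.
move=> G0; rewrite /cell -truncn_div ?expn_gt0 ?bpos// ?mulr_ge0//.
by rewrite natrX exprD mulrAC mulfK// expf_neq0// gt_eqF// ltr0n.
Qed.

Lemma measurable_cell G i (S : set nat) : measurable_fun setT G ->
  measurable [set x | S (cell G i x)].
Proof.
move=> mG; apply: (@measurable_truncn R S (fun x => b%:R ^+ i * G x)).
exact: measurable_funM.
Qed.

Lemma pc_ge0 G i s : 0 <= pc G i s. Proof. exact: prob_ge0. Qed.
Lemma pc_le1 G i s : pc G i s <= 1. Proof. exact: prob_le1. Qed.

Section Fixed.
Variables (G : R -> R) (B : nat).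
Hypothesis mG : measurable_fun setT G.
Hypothesis G0 : forall x : R, 0 <= x < 1 -> 0 <= G x < B%:R.

Lemma cell_lt i x : 0 <= x < 1 -> (cell G i x < B * b ^ i)%N.
Proof.
move=> /G0/andP[g0 gB]; rewrite truncn_lt_nat ?mulr_ge0// natrM natrX mulrC.
by rewrite ltr_pM2r// exprn_gt0// ltr0n.
Qed.

Lemma prob_cells i (S : set nat) :
  prob [set x | S (cell G i x)] = \sum_(s < B * b ^ i) ind (S s) * pc G i s.
Proof.
rewrite (@prob_part _ (B * b ^ i) (cell G i)); last 3 first.
- exact: measurable_cell.
- by move=> s; exact: (measurable_cell i (fun t => t = s) mG).
- by move=> x; exact: cell_lt.
apply: eq_bigr => s _; have [Ss|nS] := pselect (S s).
  by rewrite ind1// mul1r; apply: eq_prob => x x01 /=; split => [[]//|->].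
by rewrite ind0// mul0r -[RHS](@prob0 R); apply: eq_prob => x x01 /=; split => // -[+ e]; rewrite e.
Qed.

Lemma pc_sum i : \sum_(s < B * b ^ i) pc G i s = 1.
Proof.
rewrite -[RHS](@probT R) (_ : setT = [set x | setT (cell G i x)])//.
by rewrite prob_cells; apply: eq_bigr => s _; rewrite ind1// mul1r.
Qed.

Lemma pc_split i m s : pc G i s = \sum_(r < b ^ m) pc G (i + m) (s * b ^ m + r).
Proof.
have bm : (0 < b ^ m)%N by rewrite expn_gt0 bpos.
rewrite {1}/pc (@prob_part _ (b ^ m) (fun x => cell G (i + m) x %% b ^ m)%N); last 3 first.
- exact: (measurable_cell i (fun t => t = s) mG).
- by move=> r; exact: (measurable_cell (i + m) (fun t => (t %% b ^ m)%N = r) mG).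
- by move=> x _; rewrite ltn_pmod.
apply: eq_bigr => r _; apply: eq_prob => x /G0/andP[g0 _] /=.
rewrite (cell_div i m g0); split => [[<- <-]|->]; first by rewrite -divn_eq.
by rewrite divnMDl// divn_small// addn0 modnMDl modn_small.
Qed.

Lemma pc_sub_le i m s r : (r < b ^ m)%N -> pc G (i + m) (s * b ^ m + r) <= pc G i s.
Proof.
move=> rb; rewrite (pc_split i m s) (bigD1 (Ordinal rb))//= lerDl.
by apply: sumr_ge0 => *; exact: pc_ge0.
Qed.

Lemma ratio01 i m s r : (r < b ^ m)%N ->
  0 <= pc G (i + m) (s * b ^ m + r) / pc G i s <= 1.
Proof.
move=> rb; rewrite divr_ge0 ?pc_ge0//=; have := pc_sub_le i s rb.
have := pc_ge0 G i s; rewrite le_eqVlt => /predU1P[<-|p0]; first by rewrite invr0 mulr0.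
by rewrite ler_pdivrMr// mul1r.
Qed.

Lemma Hl_ge0 i m s : 0 <= Hl G i m s.
Proof.
rewrite /Hl oppr_ge0; apply: sumr_le0 => r _; exact/xlnx_le0/ratio01.
Qed.

(** The factor [pc G i s] cancels the normalization; if it is 0, all subcells have mass 0 and both
    sides vanish. *)
Lemma pcHl i m s : pc G i s * Hl G i m s =
  - \sum_(r < b ^ m) pc G (i + m) (s * b ^ m + r) *
                     ln (pc G (i + m) (s * b ^ m + r) / pc G i s).
Proof.
rewrite /Hl mulrN mulr_sumr; congr (- _); apply: eq_bigr => r _.
have [p0|p0] := eqVneq (pc G i s) 0; last by rewrite mulrA [_ * (_ / _)]mulrC divfK.
have := pc_sub_le i s (ltn_ord r); rewrite p0 => pr.
suff -> : pc G (i + m) (s * b ^ m + r) = 0 by rewrite !mul0r.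
by apply/eqP; rewrite eq_le pr pc_ge0.
Qed.

Lemma ent_chain i m : \sum_(s < B * b ^ i) pc G i s * Hl G i m s = ent G B (i + m) - ent G B i.
Proof.
rewrite /ent opprK expnD mulnA (big_split_index _ _ (fun s => pc G (i + m) s * ln (pc G (i + m) s))).
rewrite -sumrN -big_split/=.
apply: eq_bigr => s _; rewrite pcHl [X in _ = _ + X * _](pc_split i m).
rewrite mulr_suml -!sumrN -big_split/=; apply: eq_bigr => r _.
have := pc_ge0 G (i + m) (s * b ^ m + r); rewrite le_eqVlt => /predU1P[<-|pr].
  by rewrite !mul0r oppr0 addr0.
rewrite ln_div ?posrE//; last by rewrite (lt_le_trans pr)// pc_sub_le.
by rewrite mulrBr opprB addrC.
Qed.

Lemma ent_ge0 i : 0 <= ent G B i.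
Proof.
rewrite /ent oppr_ge0; apply: sumr_le0 => s _; apply: xlnx_le0.
by rewrite pc_ge0 pc_le1.
Qed.

Lemma ent_mono i m : ent G B i <= ent G B (i + m).
Proof.
rewrite -subr_ge0 -ent_chain; apply: sumr_ge0 => s _.
by rewrite mulr_ge0 ?pc_ge0 ?Hl_ge0.
Qed.

(** After telescoping, [m] differences remain. Each is at most the entropy at the finest level,
    since entropy is nonnegative and grows with the level. *)
Lemma ent_telescope k m :
  \sum_(1 <= i < k.+1) (ent G B (i + m) - ent G B i) <= m%:R * ent G B (k + m).
Proof.
rewrite telescope_shift mulr_natl -[m in _ *+ m]card_ord -sumr_const; apply: ler_sum => a _.
apply: (@le_trans _ _ (ent G B (k + a).+1)); first by rewrite gerBl ent_ge0.
have -> : (k + m = (k + a).+1 + (m - a.+1))%N by have := ltn_ord a; lia.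
exact: ent_mono.
Qed.

(** Masses of balls control neighbourhoods of a cell rather than the cell itself. Gibbs' inequality
    tolerates this: the neighbourhood masses [Q] add up to at most 2A + 1, so a multiple of them is
    a legitimate comparison weight. *)
Lemma ent_upper i A (tau eta : R) : 0 < tau <= 1 ->
  prob [set x | prob [set y | nearby A (cell G i x) (cell G i y)] < tau] <= eta ->
  ent G B i <= ln (2 * A.*2.+1%:R) - ln tau + eta * (ln 2 + ln (B * b ^ i)%:R).
Proof.
move=> /andP[t0 t1] bad; set N := (B * b ^ i)%N.
have N0 : (0 < N)%N by apply: leq_ltn_trans (cell_lt i (x := 0) _); rewrite // lexx ltr01.
have N0' : (0 < N%:R :> R) by rewrite ltr0n.
pose Q s := prob [set y | nearby A s (cell G i y)].
pose M : R := A.*2.+1%:R.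
have M0 : 0 < M by rewrite ltr0n.
(* Half of the weight comes from [Q] and serves the good cells; the uniform half limits the cost of
   a bad cell to ln (2 N). *)
pose q s := Q s / (2 * M) + (2 * N%:R)^-1.
have Q0 s : 0 <= Q s by exact: prob_ge0.
have q0 s : 0 < q s.
  by rewrite ltr_wpDl ?divr_ge0 ?invr_gt0 ?mulr_gt0// mulr_ge0// ltW.
have EQ s : Q s = \sum_(t < N) ind (nearby A s t) * pc G i t.
  exact: (prob_cells i (fun t => nearby A s t)).
have SQ : \sum_(s < N) Q s <= M.
  have -> : \sum_(s < N) Q s = \sum_(t < N) (\sum_(s < N) nearby A s t)%:R * pc G i t.
    under eq_bigr => s _ do rewrite (EQ s).
    rewrite exchange_big/=; apply: eq_bigr => t _; rewrite natr_sum mulr_suml.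
    by apply: eq_bigr => s _; rewrite /ind; case: (nearby _ _ _); [rewrite asboolT|rewrite asboolF].
  rewrite -[leRHS]mulr1 -[X in _ <= _ * X](pc_sum i) mulr_sumr; apply: ler_sum => t _.
  by rewrite ler_wpM2r ?pc_ge0// ler_nat nearby_count.
have Sq : \sum_(s < N) q s <= \sum_(s < N) pc G i s.
  rewrite pc_sum big_split/= -mulr_suml sumr_const card_ord.
  have -> : (2 * N%:R)^-1 *+ N = 2^-1 :> R.
    by rewrite -[_ *+ N]mulr_natr invfM -mulrA mulVf ?mulr1// gt_eqF.
  have : (\sum_(i < N) Q i) / (2 * M) <= 2^-1.
    by rewrite ler_pdivrMr ?mulr_gt0// mulrA mulVf// mul1r.
  by move=> h; rewrite [leRHS](splitr 1) mul1r lerD2r.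
have := @gibbs R 'I_N (fun s => pc G i s) (fun s => q s).
move=> /(_ (fun s => pc_ge0 G i s) (fun s => ltW (q0 s)) (fun s _ => q0 s) Sq).
rewrite -lerN2 => g; rewrite /ent (le_trans g)// -sumrN.
set c1 := ln (2 * A.*2.+1%:R) - ln tau; set c2 := ln 2 + ln N%:R.
have c10 : 0 <= c1.
  rewrite subr_ge0 (le_trans (ln_le0 t1))// ln_ge0// -natrM ler1n; lia.
have c20 : 0 <= c2 by rewrite addr_ge0// ln_ge0// ?ler1n// ler1n.
apply: (@le_trans _ _ (\sum_(s < N) (c1 * pc G i s + c2 * (ind (Q s < tau) * pc G i s)))).
  apply: ler_sum => s _; rewrite mulrA -mulrDl [leRHS]mulrC -mulrN ler_wpM2l ?pc_ge0//.
  have [Qt|/negP] := pselect (Q s < tau).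
    rewrite ind1// mulr1; apply: (@le_trans _ _ c2); last by rewrite lerDr.
    rewrite lerNl /c2 -lnM ?posrE// -lnV ?posrE ?mulr_gt0//.
    by rewrite ler_ln ?posrE ?invr_gt0 ?mulr_gt0// lerDr divr_ge0// mulr_ge0// ltW.
  rewrite -leNgt => tQ; rewrite ind0; last by apply/negP; rewrite -leNgt.
  rewrite mulr0 addr0 lerNl opprB -ln_div ?posrE ?mulr_gt0//.
  rewrite ler_ln ?posrE ?divr_gt0 ?mulr_gt0//.
  by rewrite (@le_trans _ _ (Q s / (2 * M)))// ?lerDl ?invr_ge0 ?ler_pM2r ?invr_gt0 ?mulr_gt0// mulr_ge0.
rewrite big_split/= -!mulr_sumr pc_sum mulr1 -(prob_cells i (fun s => Q s < tau)) lerD2l mulrC.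
by rewrite ler_wpM2r.
Qed.

End Fixed.

(** * Lower bound for the entropy inside a cell *)

Section Lower.
Variables (G : R -> R) (B : nat).
Hypothesis mG : measurable_fun setT G.
Hypothesis G0 : forall x : R, 0 <= x < 1 -> 0 <= G x < B%:R.
Variables (n i m : nat) (tau eta : R).
Hypothesis (t01 : 0 < tau <= 1).

Definition inside (w : seq 'I_b) (s : nat) : Prop :=
  forall x : R, 0 <= x < 1 -> cell G i (Hw w x) = s.

(** Heavy cells carry little of such a piece, which forces its entropy at level i + m to be at least
    (1 - eta) (- ln tau) once it lies inside one cell. *)
Definition wgood (w : seq 'I_b) : Prop :=
  prob [set x | tau < pc (G \o Hw w) (i + m) (cell G (i + m) (Hw w x))] <= eta.

(* The part of the mass of the cell [s] carried by the pieces [Hw w] that lie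
   inside it and are spread over many cells of level [i + m]. *)
Definition acount s : R := avg n (fun w => ind (inside w s /\ wgood w)).

Lemma pc_avg l s : pc G l s = avg n (fun w : seq 'I_b => pc (G \o Hw w) l s).
Proof.
rewrite /pc (prob_avg b2 n); first exact: eq_avg.
exact: (measurable_cell l (fun t => t = s) mG).
Qed.

Lemma acount_le s : acount s <= pc G i s.
Proof.
rewrite pc_avg; apply: avg_le => w _.
have [[int wg]|nint] := pselect (inside w s /\ wgood w); last by rewrite ind0// pc_ge0.
rewrite (_ : ind _ = prob setT); last by rewrite probT (ind1 (conj int wg)).
by apply: probS => x x01 _ /=; exact: int.
Qed.

Let mGH (w : seq 'I_b) : measurable_fun setT (G \o Hw w).
Proof. by apply: measurableT_comp => //; exact: measurable_Hw. Qed.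

Let GH0 (w : seq 'I_b) (x : R) : 0 <= x < 1 -> 0 <= (G \o Hw w) x < B%:R.
Proof. by move=> x01; apply/G0/Hw01. Qed.

Lemma pcHw_sum (w : seq 'I_b) s : inside w s ->
  \sum_(r < b ^ m) pc (G \o Hw w) (i + m) (s * b ^ m + r) = 1.
Proof.
move=> int; rewrite -(pc_split (mGH w) (GH0 w)).
rewrite -(@probT R); apply: eq_prob => x x01 /=; split => // _; exact: int.
Qed.

Lemma wgood_sum (w : seq 'I_b) s : inside w s -> wgood w ->
  \sum_(r < b ^ m) ind (tau < pc (G \o Hw w) (i + m) (s * b ^ m + r)) *
     pc (G \o Hw w) (i + m) (s * b ^ m + r) <= eta.
Proof.
move=> int; apply: le_trans; set p := pc _ _.
have bm : (0 < b ^ m)%N by rewrite expn_gt0 bpos.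
pose S := fun t : nat => tau < p t.
rewrite (@prob_part _ (b ^ m) (fun x => cell (G \o Hw w) (i + m) x %% b ^ m)%N); last 3 first.
- exact: (measurable_cell (i + m) S (mGH w)).
- by move=> r; exact: (measurable_cell (i + m) (fun t => (t %% b ^ m)%N = r) (mGH w)).
- by move=> x _; rewrite ltn_pmod.
apply: ler_sum => r _; have [pr|npr] := pselect (tau < p (s * b ^ m + r)%N); last first.
  by rewrite ind0// mul0r prob_ge0.
rewrite ind1// mul1r; apply: probS => x x01 /= e.
split; first by move: e; rewrite /cell /= => ->.
by rewrite e modnMDl modn_small.
Qed.

(** Concavity of entropy: the entropy of the cell is a mean over [w] of cross entropies of pieces
    against the whole. By Gibbs' inequality a counted piece contributes at least its own entropy;
    the other contributions are nonnegative. *)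
Lemma lower s : eta <= 1 ->
  acount s * ((1 - eta) * - ln tau) <= pc G i s * Hl G i m s.
Proof.
move=> eta1; rewrite (pcHl mG G0).
have /andP[t0 t1] := t01.
have lt0 : 0 <= - ln tau by rewrite oppr_ge0 ln_le0.
pose p r := pc G (i + m) (s * b ^ m + r).
have pw0 (w : seq 'I_b) r : 0 <= pc (G \o Hw w) (i + m) (s * b ^ m + r) by exact: pc_ge0.
have -> : - \sum_(r < b ^ m) pc G (i + m) (s * b ^ m + r) * ln (pc G (i + m) (s * b ^ m + r) / pc G i s)
  = avg n (fun w : seq 'I_b => \sum_(r < b ^ m) (- ln (p r / pc G i s)) * pc (G \o Hw w) (i + m) (s * b ^ m + r)).
  rewrite avg_sum -sumrN; apply: eq_bigr => r _.
  by rewrite avgZ -pc_avg mulNr mulrC.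
rewrite mulrC -avgZ; apply: avg_le => w wn.
have [[int wg]|nint] := pselect (inside w s /\ wgood w); last first.
  rewrite ind0// mulr0; apply: sumr_ge0 => r _; rewrite mulr_ge0// oppr_ge0 ln_le0//.
  by have /andP[] := ratio01 mG G0 i s (ltn_ord r).
rewrite ind1// mulr1.
have := @gibbs R 'I_(b ^ m) (fun r => pc (G \o Hw w) (i + m) (s * b ^ m + r)) (fun r => p r / pc G i s).
have h1 (r : 'I_(b ^ m)) : 0 <= p r / pc G i s by rewrite divr_ge0 ?pc_ge0.
(* A mean of nonnegative masses vanishes only if each of them does, so every piece is absolutely
   continuous with respect to the whole. *)
have h2 (r : 'I_(b ^ m)) : 0 < pc (G \o Hw w) (i + m) (s * b ^ m + r) -> 0 < p r / pc G i s.
  move=> pwr; have pr : 0 < p r.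
    rewrite lt_neqAle pc_ge0 andbT eq_sym; apply/negP => /eqP.
    rewrite /p pc_avg => /(avg_eq0 b2 (fun v _ => pw0 v r)) /(_ w wn) => h.
    by move: pwr; rewrite h ltxx.
  by rewrite divr_gt0// (lt_le_trans pr)// (pc_sub_le mG G0).
have h3 : \sum_(r < b ^ m) p r / pc G i s <= \sum_(r < b ^ m) pc (G \o Hw w) (i + m) (s * b ^ m + r).
  rewrite (pcHw_sum int) -mulr_suml -(pc_split mG G0 i m s).
  by have [->|p0] := eqVneq (pc G i s) 0; rewrite ?mul0r// divff.
move=> /(_ (fun r => pw0 w r) h1 h2 h3); rewrite -lerN2 => g.
apply: (@le_trans _ _ (- \sum_(r < b ^ m) pc (G \o Hw w) (i + m) (s * b ^ m + r) * ln (pc (G \o Hw w) (i + m) (s * b ^ m + r)))); last first.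
  by apply: (le_trans g); rewrite -sumrN; apply: ler_sum => r _; rewrite mulNr mulrC.
have := wgood_sum int wg; have := pcHw_sum int; set q := pc _ _ => q1 qe.
(* A cell of mass q <= tau contributes at least - q ln tau; heavier cells contribute at least 0. *)
apply: (@le_trans _ _ (\sum_(r < b ^ m) (- ln tau * q (s * b ^ m + r)%N - - ln tau * (ind (tau < q (s * b ^ m + r)%N) * q (s * b ^ m + r)%N)))).
  by rewrite sumrB -!mulr_sumr q1 -mulrBr mulrC ler_wpM2l// lerB.
rewrite -sumrN; apply: ler_sum => r _; set qr := q _.
have qr0 : 0 <= qr by exact: pc_ge0.
have [tq|/negP] := pselect (tau < qr).
  by rewrite ind1// mul1r subrr oppr_ge0 xlnx_le0// qr0 pc_le1.
rewrite -leNgt => qt; rewrite ind0; last by apply/negP; rewrite -leNgt.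
rewrite mul0r mulr0 subr0 mulNr lerN2 mulrC.
have [->|qn] := eqVneq qr 0; first by rewrite !mulr0.
by rewrite ler_wpM2r// ler_ln ?posrE// lt_neqAle eq_sym qn.
Qed.

Lemma acount_sum (N : nat) : (N = B * b ^ i)%N ->
  1 - avg n (fun w : seq 'I_b => ind (~ exists s, inside w s)) - avg n (fun w : seq 'I_b => ind (~ wgood w))
    <= \sum_(s < N) acount s.
Proof.
move=> NE; rewrite /acount -avg_sum lerBlDr lerBlDr -!avgD -[leLHS](avg_cst b2 n).
apply: avg_le => w wn.
have S0 : 0 <= \sum_(s < N) ind (inside w s /\ wgood w) :> R.
  by apply: sumr_ge0 => s _; exact: ind_ge0.
have [[s int]|nint] := pselect (exists s, inside w s); last first.
  by rewrite (ind1 nint) lerDr addr_ge0// ind_ge0.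
have [wg|nwg] := pselect (wgood w); last first.
  by rewrite (ind1 nwg) addrAC lerDr addr_ge0// ind_ge0.
rewrite -addrA; apply: ler_wpDr; first by rewrite addr_ge0// ind_ge0.
have x01 : 0 <= (0 : R) < 1 by rewrite lexx ltr01.
have sN : (s < N)%N.
  by rewrite -(int 0 x01) NE; apply: (cell_lt G0); exact: Hw01.
by rewrite (bigD1 (Ordinal sN))//= ind1// lerDl sumr_ge0// => *; exact: ind_ge0.
Qed.

End Lower.
End Cells.

(* Markov's inequality when the pointwise lower bound only holds on the part
   [a] of the mass [p]. *)
Lemma high_mass {R : realType} (I : finType) (p a h : I -> R) (al' al eps e : R) :
  (forall i, 0 <= a i <= p i) -> (forall i, 0 <= h i) ->
  (forall i, a i * al' <= p i * h i) -> \sum_i p i = 1 -> 1 - e <= \sum_i a i ->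
  0 <= al' <= al -> 0 < eps ->
  eps * (\sum_i ind (al + eps <= h i) * p i) <= \sum_i p i * h i - al' + e * al'.
Proof.
move=> ap h0 aph p1 ae /andP[al0 al1] eps0.
set P := \sum_i ind _ * p i.
have : \sum_i (ind (al + eps <= h i) * p i * (al + eps) + (a i - ind (al + eps <= h i) * p i) * al')
   <= \sum_i p i * h i.
  apply: ler_sum => i _; have /andP[a0 api] := ap i.
  have [hi|nhi] := pselect (al + eps <= h i); last by rewrite ind0// !mul0r add0r subr0.
  rewrite ind1// mul1r; apply: (@le_trans _ _ (p i * (al + eps))).
    by rewrite gerDl mulr_le0_ge0// subr_le0.
  by rewrite ler_wpM2l// (le_trans a0).
rewrite big_split/= -!mulr_suml sumrB -/P => H.
have P0 : 0 <= P.
  by apply: sumr_ge0 => i _; rewrite mulr_ge0 ?ind_ge0//; have /andP[a0] := ap i; exact: le_trans.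
have := ler_wpM2r al0 ae; have : P * al' <= P * al by rewrite ler_wpM2l.
by move: H; set A := \sum_i a i; set U := \sum_i _; nra.
Qed.

Lemma expr_cvg0 {R : realType} (g : R) : 0 <= g < 1 -> (fun n => g ^+ n) @ \oo --> 0.
Proof. by move=> /andP[g0 g1]; apply: cvg_expr; rewrite ger0_norm. Qed.

Lemma expr_small {R : realType} (g e : R) : 0 <= g < 1 -> 0 < e ->
  exists n, forall m, (n <= m)%N -> g ^+ m <= e.
Proof.
move=> g01 e0; have /cvgrPdist_le/(_ _ e0)[n _ hn] := expr_cvg0 g01.
exists n => m nm; have := hn m nm; rewrite /= sub0r normrN ger0_norm//.
by rewrite exprn_ge0//; case/andP: g01.
Qed.

Lemma prob_exists_le {R : realType} (n : nat) (F : nat -> set R) :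
  prob [set x | exists2 s, (s < n)%N & F s x] <= \sum_(s < n) prob (F s).
Proof.
elim: n => [|n IH].
  by rewrite big_ord0 -(@prob0 R); apply: probS => x _ [].
rewrite big_ord_recr/=; apply: le_trans (lerD IH (lexx _)).
apply: le_trans (prob_subadd _ _); apply: probS => x _ [s].
by rewrite ltnS leq_eqVlt => /predU1P[->|sn] Fs; [right|left; exists s].
Qed.

(** * Porosity for an abstract family X *)

Section Core.
Context {R : realType} {b : nat} (b2 : (2 <= b)%N).
Variables (lam gam C al : R) (X : (nat -> 'I_b) -> R -> R).
Hypothesis lam_bnd : b%:R^-1 < lam < 1.
Hypothesis gam01 : 0 <= gam < 1.
Hypothesis C0 : 0 < C.
Hypothesis mX : forall j, measurable_fun setT (X j).
Hypothesis bX : forall j (x : R), 0 <= x < 1 -> `|X j x| <= C.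
Hypothesis sX : forall i j, exists c, forall x : R, 0 <= x < 1 ->
  X j (branch i x) = lam * X (scat [:: i] j) x + c.
Hypothesis cX : forall l j j', (forall k, (k < l)%N -> j k = j' k) ->
  forall x : R, 0 <= x < 1 -> `|X j x - X j' x| <= C * gam ^+ l.
Hypothesis edX : nu_outer R b [set j | ~ exact_dim (law (X j)) al] = 0%E.

Let bR0 : 0 < b%:R :> R. Proof. by rewrite ltr0n (leq_trans _ b2). Qed.
Let lnb0 : 0 < ln b%:R :> R. Proof. by rewrite ln_gt0// ltr1n. Qed.
Let binv01 : 0 <= (b%:R^-1 : R) < 1.
Proof. by rewrite invr_ge0 ltW//= invf_lt1// ltr1n. Qed.
Let lam0 : 0 < lam. Proof. by case/andP: lam_bnd => h _; apply: le_lt_trans h; rewrite invr_ge0 ltW. Qed.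
Let lam1 : lam < 1. Proof. by case/andP: lam_bnd. Qed.
Let x001 : 0 <= (0 : R) < 1. Proof. by rewrite lexx ltr01. Qed.

Lemma ln_binvX m : ln ((b%:R^-1 : R) ^+ m) = - (m%:R * ln b%:R).
Proof. by rewrite lnXn ?invr_gt0// lnV// mulNrn mulr_natl. Qed.

Lemma X_Hw (w : seq 'I_b) j : exists c, forall x : R, 0 <= x < 1 ->
  X j (Hw w x) = lam ^+ size w * X (scat w j) x + c.
Proof.
elim: w => [|i w [c IH]].
  by exists 0 => x x01; rewrite /= scat_nil mul1r addr0.
have [c' h] := sX i (scat w j).
exists (lam ^+ size w * c' + c) => x x01 /=.
by rewrite IH ?branch01// h// (scat_cons i w j) mulrDr mulrA -exprSr addrA.
Qed.

(** The logarithms of a mass and of a small radius are both nonpositive. A sequence and a point at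
    which the limit exists are found because null sets do not exhaust the space. *)
Lemma al_ge0 : 0 <= al.
Proof.
have [j /contrapT[Nul [mN N0 hN]]] : exists j, ~ ~ exact_dim (law (X j)) al.
  apply: contrapT => h; have := nu_outer_ge (R := R) b2 [set j | ~ exact_dim (law (X j)) al].
  rewrite edX (_ : [set x | _] = setT) ?probT ?lee_fin ?ler10//.
  by apply/seteqP; split => // x _ /=; apply: contrapT => h'; apply: h; exists (dig b2 x).
have [x [x01 nN]] : exists x : R, 0 <= x < 1 /\ ~ Nul (X j x).
  apply: contrapT => h; have : prob [set x : R | Nul (X j x)] = 1.
    rewrite -(@probT R); apply: eq_prob => x x01 /=; split => // _.
    by apply: contrapT => nN; apply: h; exists x.
  by move: N0; rewrite /law => -> /eqP; rewrite eq_sym oner_eq0.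
have := hN _ nN; set F := fun r => _ => cv.
rewrite -(cvg_lim _ cv)//; apply: limr_ge; first by apply/cvg_ex; exists al.
near=> r; rewrite /F; apply: mulr_le0; first by rewrite ln_le0// prob_le1.
rewrite invr_le0 ln_le0//; near: r; exact: nbhs_right_le.
Unshelve. all: by end_near. Qed.

(* The slack of 3 in the radii absorbs a change of the far letters of [j]. *)
Definition badj (d eta r : R) (j : nat -> 'I_b) : Prop :=
  eta < prob [set x | bmass (X j) x (3 * r) < expR ((al + d) * ln r)] \/
  eta < prob [set x | expR ((al - d) * ln r) < bmass (X j) x (r / 3)].

Definition badw (d eta r : R) (w : seq 'I_b) : Prop := exists z, badj d eta r (scat w z).

Lemma bad_avg (r : nat -> R) (d eta : R) : (forall m, 0 < r m) -> r @ \oo --> 0 ->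
  0 < d -> 0 < eta ->
  exists M, forall m, (M <= m)%N -> exists N, forall n, (N <= n)%N ->
    avg n (fun w => ind (badw d eta (r m) w)) <= eta.
Proof.
move=> r0 rcv d0 eta0.
(* Sequences that agree on [l m] letters give values within r/3, so differences of values change by
   at most 2r/3: a ball of radius r/3 grows into one of radius r, and one of radius r stays within
   radius 3r. *)
have hl m : {l : nat | C * gam ^+ l <= r m / 3}.
  apply: cid; have [n hn] := expr_small gam01 (divr_gt0 (divr_gt0 (r0 m) (ltr0n _ 3)) C0).
  by exists n; rewrite mulrC -ler_pdivlMr// hn.
pose l m := projT1 (hl m).
have [||M hM] := @eventually_avg R b b2
   (fun m j => eta < prob [set x | lowmass (X j) al d (r m) x \/ highmass (X j) al d (r m) x])
   (fun m j => badj d eta (r m) j) l _ _ edX _ eta eta0.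
- move=> m j j' jj'.
  have D x : 0 <= x < 1 -> `|X j x - X j' x| <= r m / 3.
    by move=> x01; apply: le_trans (cX jj' x01) _; exact: (projT2 (hl m)).
  case=> /lt_le_trans; apply; apply: probS => x x01 /= h.
  + left; apply: le_lt_trans h; apply: bmass_le => y y01.
    have := D x x01; have := D y y01; rewrite !ltr_norml !ler_norml.
    move=> /andP[? ?] /andP[? ?] /andP[? ?]; have := r0 m => ?; apply/andP; split; lra.
  + right; apply: (lt_le_trans h); apply: bmass_le => y y01.
    have := D x x01; have := D y y01; rewrite !ltr_norml !ler_norml.
    move=> /andP[? ?] /andP[? ?] /andP[? ?]; have := r0 m => ?; apply/andP; split; lra.
- move=> j /contrapT edj.
  have [M hM] := exact_dim_atypical (mX j) (@bX j) edj r0 rcv d0 eta0.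
  by exists M => m /hM; rewrite leNgt => /negP.
by exists M => m Mm; exists (l m) => n; exact: hM.
Qed.

(** Either all points over the interval of radius r/6 are atypical, and they have measure at most
    [eta], or the interval lies in the (r/3)-ball around a typical point, which is light. *)
Lemma no_atom d eta r w z (c : R) : 0 < r -> ~ badw d eta r w ->
  prob [set x | `|X (scat w z) x - c| < r / 6] <= eta + expR ((al - d) * ln r).
Proof.
move=> r0 nb; set j := scat w z; set S := [set x | _].
have [eta0 hj] : 0 <= eta /\ prob [set x | expR ((al - d) * ln r) < bmass (X j) x (r / 3)] <= eta.
  have h : prob [set x | expR ((al - d) * ln r) < bmass (X j) x (r / 3)] <= eta.
    by rewrite leNgt; apply/negP => h; apply: nb; exists z; right.
  by split=> //; apply: le_trans h; exact: prob_ge0.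
have [[x [x01 [Sx nh]]]|h] := pselect (exists x : R, 0 <= x < 1 /\ S x /\
    ~ (expR ((al - d) * ln r) < bmass (X j) x (r / 3))).
  apply: ler_wpDl => //; move/negP: nh; rewrite -leNgt; apply: le_trans.
  apply: probS => y y01; move: Sx; rewrite /S/= !ltr_norml => /andP[? ?] /andP[? ?].
  by apply/andP; split; lra.
apply: ler_wpDr; first exact: expR_ge0.
apply: le_trans hj; apply: probS => x x01 Sx /=; apply: contrapT => nh.
by apply: h; exists x.
Qed.

(** * Affine images of X_J and their small copies *)

Section Projection.
Variables (v : seq 'I_b) (z : nat -> 'I_b) (th c : R) (B : nat).
Let J := scat v z.
Let G x := th * X J x + c.
Hypothesis th_bnd : lam ^+ 2 < th <= 1.
Hypothesis G0 : forall x : R, 0 <= x < 1 -> 0 <= G x < B%:R.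

Let th0 : 0 < th. Proof. by case/andP: th_bnd => h _; apply: le_lt_trans h; rewrite sqr_ge0. Qed.

Lemma mG : measurable_fun setT G.
Proof. by apply: measurable_funD => //; apply: measurable_funM. Qed.

Lemma G_Hw w : exists c', forall x : R, 0 <= x < 1 ->
  G (Hw w x) = th * lam ^+ size w * X (scat (w ++ v) z) x + c'.
Proof.
have [c' h] := X_Hw w J; exists (th * c' + c) => x x01.
by rewrite /G h// scat_cat mulrDr mulrA addrA.
Qed.

Lemma ent_G_upper T d eta : 0 <= al + d -> ~ badw d eta (b%:R^-1 ^+ T) v ->
  ent (b := b) G B T <= ln 14 + T%:R * (al + d) * ln b%:R + eta * (ln 2 + ln (B * b ^ T)%:R).
Proof.
move=> ad nb; have r0 : 0 < (b%:R^-1 : R) ^+ T by rewrite exprn_gt0// invr_gt0.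
have lr : ln ((b%:R^-1 : R) ^+ T) = - (T%:R * ln b%:R).
  exact: ln_binvX.
have hb : prob [set x | bmass (X J) x (3 * b%:R^-1 ^+ T) < expR ((al + d) * ln (b%:R^-1 ^+ T))] <= eta.
  by rewrite leNgt; apply/negP => h; apply: nb; exists z; left.
(* Since th <= 1, values of X within 3 b^-T give cells at distance at most 3; hence A = 3, and 2 (2
   A + 1) = 14. *)
have := @ent_upper R b b2 G B mG G0 T 3 (expR ((al + d) * ln (b%:R^-1 ^+ T))) eta.
rewrite expRK lr => h; apply: le_trans (h _ _) _.
- by rewrite expR_gt0 -[X in _ <= X]expR0 ler_expR/= mulrN oppr_le0 mulr_ge0// mulr_ge0// ltW.
- apply: le_trans hb; apply: probS => x x01 /=; rewrite lr; apply: le_lt_trans.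
  apply: probS => y y01 /= xy; have /andP[g0x _] := G0 x01; have /andP[g0y _] := G0 y01.
  have bT : 0 < b%:R ^+ T :> R by rewrite exprn_gt0.
  have D : `|b%:R ^+ T * G x - b%:R ^+ T * G y| < 3.
    rewrite -mulrBr normrM gtr0_norm// /G opprD addrACA subrr addr0 -mulrBr normrM gtr0_norm//.
    move: xy; rewrite exprVn ltr_pdivlMr// mulrC => xy.
    apply: le_lt_trans xy; rewrite mulrCA; apply: ler_piMl.
      by rewrite mulr_ge0// ltW.
    by case/andP: th_bnd.
  rewrite /nearby /cell; move: D; rewrite ltr_norml => /andP[D1 D2].
  have gx := mulr_ge0 (ltW bT) g0x; have gy := mulr_ge0 (ltW bT) g0y.
  have /andP[a1 a2] := truncn_itv gx; have /andP[a3 a4] := truncn_itv gy.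
  set tx := Num.truncn _ in a1 a2 *; set ty := Num.truncn _ in a3 a4 *.
  have e1 : (ty%:R : R) < (tx + 4)%:R by rewrite natrD -natr1 in a2 *; lra.
  have e2 : (tx%:R : R) < (ty + 4)%:R by rewrite natrD -natr1 in a4 *; lra.
  by move: e1 e2; rewrite !ltr_nat; clear; lia.
by rewrite -natrM mulrN opprK lerD2r lerD2l mulrCA mulrA.
Qed.

Section Scale.
Variables (i l : nat).
Hypothesis il : lam < b%:R ^+ i * lam ^+ l <= 1.

(** The factor by which b^i G, restricted to a copy of [l] letters, stretches X: it is of order one,
    between lam^3 and 1. *)
Let P : R := b%:R ^+ i * lam ^+ l * th.

Let Plow : lam ^+ 3 < P.
Proof.
rewrite /P exprSr mulrC; case/andP: il => h _; case/andP: th_bnd => h2 _.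
by apply: ltr_pM => //; rewrite ltW// exprn_gt0.
Qed.

Let Pup : P <= 1.
Proof.
rewrite /P; case/andP: il => h h1; case/andP: th_bnd => _ h2.
by rewrite mulr_ile1// ?(ltW th0)// ltW// (lt_trans lam0).
Qed.

Let P0 : 0 < P. Proof. by apply: lt_trans Plow; rewrite exprn_gt0. Qed.

Lemma G_Hw_diff q (w : seq 'I_b) m (x y : R) : size w = (q + l)%N -> 0 <= x < 1 -> 0 <= y < 1 ->
  `|b%:R ^+ (i + m) * G (Hw w x) - b%:R ^+ (i + m) * G (Hw w y)| =
  b%:R ^+ m * lam ^+ q * P * `|X (scat (w ++ v) z) x - X (scat (w ++ v) z) y|.
Proof.
move=> wq x01 y01; have [c' h] := G_Hw w.
rewrite !h// wq -mulrBr opprD addrACA subrr addr0 -mulrBr !normrM.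
rewrite (gtr0_norm th0) !(gtr0_norm (exprn_gt0 _ bR0)) (gtr0_norm (exprn_gt0 _ lam0)).
by rewrite /P !exprD; ring.
Qed.

(** Two points of the copy in one cell of level i + m satisfy b^m lam^q P |X - X'| < 1, hence |X -
    X'| < r/3 because P > lam^3. So a cell is no heavier than a ball of radius r/3. *)
Lemma wgood_of_good q m d eta (w : seq 'I_b) : size w = (q + l)%N ->
  let r := 3 * lam ^- (q + 3) * b%:R^-1 ^+ m in
  ~ badw d eta r (w ++ v) -> wgood G i m (expR ((al - d) * ln r)) eta w.
Proof.
move=> wq r nb; have hj : prob [set x | expR ((al - d) * ln r) < bmass (X (scat (w ++ v) z)) x (r / 3)] <= eta.
  by rewrite leNgt; apply/negP => h; apply: nb; exists z; right.
apply: le_trans hj; apply: probS => x x01 /= h; apply: (lt_le_trans h).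
apply: probS => y y01 /= e.
have gx : 0 <= b%:R ^+ (i + m) * G (Hw w x).
  by rewrite mulr_ge0 ?exprn_ge0 ?(ltW bR0)//; case/andP: (G0 (Hw01 b2 w x01)).
have gy : 0 <= b%:R ^+ (i + m) * G (Hw w y).
  by rewrite mulr_ge0 ?exprn_ge0 ?(ltW bR0)//; case/andP: (G0 (Hw01 b2 w y01)).
have D : `|b%:R ^+ (i + m) * G (Hw w x) - b%:R ^+ (i + m) * G (Hw w y)| < 1.
  have /andP[a1 a2] := truncn_itv gx; have /andP[a3 a4] := truncn_itv gy.
  move: e; rewrite /cell/= => e; rewrite e in a3 a4; rewrite -natr1 in a2 a4.
  by rewrite ltr_norml; apply/andP; split; lra.
rewrite (G_Hw_diff m wq)// in D.
have r3 : r / 3 = (lam ^+ (q + 3) * b%:R ^+ m)^-1.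
  have aux (a' c' : R) : 3 * a' * c' / 3 = a' * c' by field.
  rewrite /r exprVn [RHS]invfM; exact: aux.
rewrite r3 -[X in _ < X]mul1r ltr_pdivlMr ?mulr_gt0 ?exprn_gt0//.
apply: le_lt_trans D; rewrite mulrC ler_wpM2r// exprD mulrC -!mulrA ler_wpM2l ?exprn_ge0 ?(ltW bR0)//.
by rewrite ler_wpM2l ?exprn_ge0 ?(ltW lam0)// ltW.
Qed.

(** Fix the [l] letters [w2] that act last. On this copy b^i G varies by at most 2C and meets few
    integers. If [w1 ++ w2] crosses a cell boundary, its whole image stays within 2 C lam^q of one
    of them, a set that [no_atom] makes small; averaging over [w1] gives back its probability. *)
Lemma crossing_bound q d eta r : 0 < r -> 0 <= eta ->
  12 * C * lam ^+ q < lam ^+ 3 * r -> 2 * C * lam ^+ q <= 1 ->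
  avg (q + l) (fun w : seq 'I_b => ind (~ exists s, inside G i w s)) <=
  avg l (fun w2 : seq 'I_b => ind (badw d eta r (w2 ++ v))) +
  (Num.truncn (2 * C + 3)).*2.+1%:R * (eta + expR ((al - d) * ln r)).
Proof.
move=> r0 eta0 q1 q2; set D0 := Num.truncn _; set rho := eta + _.
have rho0 : 0 <= rho by rewrite addr_ge0// expR_ge0.
rewrite avg_cat avg_exch -[_ * rho](avg_cst b2 l) -avgD; apply: avg_le => w2 w2l.
have [bad|nbad] := pselect (badw d eta r (w2 ++ v)).
  rewrite (ind1 bad); apply: ler_wpDr; first by rewrite mulr_ge0.
  by rewrite -[leRHS](avg_cst b2 q); apply: avg_le => w1 _; exact: ind_le1.
rewrite ind0// add0r.
pose F x := b%:R ^+ i * G (Hw w2 x).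
pose t1 := Num.truncn (F 0).
pose pt (s : nat) : R := t1%:R + s%:R - D0%:R.
pose kap := 2 * C * lam ^+ q.
pose A (s : nat) := [set x | `|F x - pt s| <= kap].
have mF : measurable_fun setT F.
  apply: measurable_funM => //; apply: measurableT_comp; first exact: mG.
  exact: measurable_Hw.
have mA s : measurable (A s).
  rewrite (_ : A s = ~` [set x | kap < `|F x - pt s|]).
    apply: measurableC; apply: (@measurable_gt_set R (fun x => `|F x - pt s|) kap).
    by apply: measurableT_comp => //; exact: measurable_funB.
  by apply/seteqP; split => x /=; rewrite /A/= leNgt => /negP.
apply: (@le_trans _ _ (prob [set x | exists2 s, (s < D0.*2.+1)%N & A s x])); last first.
  apply: le_trans (prob_exists_le _ _) _.
  rewrite mulr_natl -[X in _ *+ X]card_ord -sumr_const; apply: ler_sum => s _.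
  have [c' h] := G_Hw w2.
  apply: le_trans (no_atom z ((pt s - b%:R ^+ i * c') / P) r0 nbad).
  apply: probS => x x01; rewrite /A/= /F h// w2l => hx.
  rewrite -(ltr_pM2l P0) -[P in P * `|_|](gtr0_norm P0) -normrM mulrBr [P * (_ / _)]mulrC divfK ?gt_eqF//.
  apply: (@le_lt_trans _ _ kap).
    by apply: le_trans hx; rewrite le_eqVlt; apply/orP; left; apply/eqP; congr `|_|; rewrite /P; ring.
  apply: (@lt_trans _ _ (lam ^+ 3 * (r / 6))); first by rewrite /kap; lra.
  by rewrite ltr_pM2r// divr_gt0.
rewrite (prob_avg b2 q); last first.
  rewrite (_ : [set x | _] = \bigcup_(s in [set s | (s < D0.*2.+1)%N]) A s).
    by apply: bigcup_measurable.
  by apply/seteqP; split => x [s sD As]; exists s.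
apply: avg_le => w1 w1q; have [cr|ncr] := pselect (~ exists s, inside G i (w1 ++ w2) s); last first.
  by rewrite ind0// prob_ge0.
rewrite (ind1 cr) -[X in X <= _](@probT R); apply: probS => y y01 _ /=.
have osc x x' : 0 <= x < 1 -> 0 <= x' < 1 -> `|F (Hw w1 x) - F (Hw w1 x')| <= kap.
  move=> x01 x01'; have wq : size (w1 ++ w2) = (q + l)%N by rewrite size_cat w1q w2l.
  have := G_Hw_diff 0 wq x01 x01'; rewrite addn0 !Hw_cat expr0 mul1r /F => ->.
  rewrite /kap [2 * C * _]mulrC; apply: ler_pM => //.
  - by rewrite mulr_ge0 ?exprn_ge0 ?(ltW lam0) ?(ltW P0).
  - by rewrite ler_piMr ?exprn_ge0 ?(ltW lam0).
  - rewrite mulr_natl mulr2n; apply: le_trans (ler_normB _ _) _; exact: lerD (bX _ x01) (bX _ x01').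
have osc2 x x' : 0 <= x < 1 -> 0 <= x' < 1 -> `|F x - F x'| <= 2 * C.
  move=> x01 x01'; have wq : size w2 = (0 + l)%N by rewrite add0n.
  have := G_Hw_diff 0 wq x01 x01'; rewrite addn0 !expr0 mul1r mul1r /F => ->.
  rewrite -[leRHS]mul1r; apply: ler_pM => //; first exact: ltW.
  rewrite mulr_natl mulr2n; apply: le_trans (ler_normB _ _) _; exact: lerD (bX _ x01) (bX _ x01').
have F0 x : 0 <= x < 1 -> 0 <= F x.
  move=> x01; rewrite /F mulr_ge0 ?exprn_ge0 ?(ltW bR0)//.
  by case/andP: (G0 (Hw01 b2 w2 x01)).
pose cl (u : R) := cell (b := b) G i (Hw (w1 ++ w2) u).
have [x [x01 nx]] : exists x : R, 0 <= x < 1 /\ cl x <> cl 0.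
  apply: contrapT => h; apply: cr; exists (cl 0) => x x01.
  by apply: contrapT => h'; apply: h; exists x.
have [p [p' [t [p01 p01' ft tf]]]] : exists p p' (t : nat), [/\ 0 <= p < 1, 0 <= p' < 1,
    F (Hw w1 p) < t%:R & t%:R <= F (Hw w1 p')].
  have T (u : R) : 0 <= u < 1 -> (cl u)%:R <= F (Hw w1 u) < (cl u).+1%:R.
    by move=> u01; rewrite /cl /cell Hw_cat; apply: truncn_itv; apply: F0; exact: Hw01.
  have /andP[a1 a2] := T _ x01; have /andP[a3 a4] := T _ x001.
  case: (ltngtP (cl x) (cl 0)) => // lt.
  - exists x, 0, (cl 0); split => //.
    by apply: (lt_le_trans a2); rewrite ler_nat.
  - exists 0, x, (cl x); split => //.
    by apply: (lt_le_trans a4); rewrite ler_nat.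
have H01 (u : R) : 0 <= u < 1 -> 0 <= Hw w1 u < 1 by exact: Hw01.
have near_t : `|F (Hw w1 y) - t%:R| <= kap.
  have := osc _ _ y01 p01; have := osc _ _ y01 p01'.
  rewrite !ler_norml => /andP[? ?] /andP[? ?]; apply/andP; split; lra.
have kap1 : kap <= 1 by [].
have /andP[a1 a2] := truncn_itv (F0 _ x001); rewrite -/t1 -natr1 in a1 a2.
(* The crossed integer [t] is within 2C + 2 of [t1]: 2C for the variation of F, 1 for [kap] and 1
   for the truncation. *)
have D0r : 2 * C + 3 < D0%:R + 1.
  have h0 : 0 <= 2 * C + 3 by rewrite addr_ge0// mulr_ge0// ltW.
  by rewrite natr1; have /andP[] := truncn_itv h0.
have := osc2 _ _ (H01 _ y01) x001; move: near_t; rewrite !ler_norml => /andP[n1 n2] /andP[n3 n4].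
have tt1 : (t <= t1 + D0)%N by rewrite -(ler_nat R) natrD; lra.
have tt2 : (t1 <= t + D0)%N by rewrite -(ler_nat R) natrD; lra.
exists (t + D0 - t1)%N; first by move: tt1 tt2; clear; lia.
rewrite /A/= /pt natrB// natrD.
have -> : t1%:R + (t%:R + D0%:R - t1%:R) - D0%:R = t%:R :> R by ring.
by rewrite ler_norml n1 n2.
Qed.

End Scale.

End Projection.
(** The least [l] satisfying the upper bound; one letter less exceeds 1, whence the lower bound. *)
Lemma level i : {l | lam < b%:R ^+ i * lam ^+ l <= 1}.
Proof.
apply: cid.
have bi : 0 < b%:R ^+ i :> R by rewrite exprn_gt0.
have ex : exists l, b%:R ^+ i * lam ^+ l <= 1.
  have [||l hl] := @expr_small R lam (b%:R ^+ i)^-1 _ _.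
  - by rewrite lam1 ltW.
  - by rewrite invr_gt0.
  - by exists l; rewrite mulrC -ler_pdivlMr// mul1r hl.
have [l hl minl] := ex_minnP ex; exists l; rewrite hl andbT.
case: l hl minl => [|l] hl minl.
  rewrite expr0 mulr1; apply: (lt_le_trans lam1); rewrite exprn_ege1// ler1n (leq_trans _ b2)//.
have : 1 < b%:R ^+ i * lam ^+ l by rewrite ltNge; apply/negP => /minl; rewrite ltnn.
by move=> h; rewrite exprS mulrCA -[X in X < _]mulr1 ltr_pM2l.
Qed.

(* [th] will be a product of two factors in ]lam, 1], one for each of the words
   u and i_1 ... i_n; whence lam^2. *)
Definition admissible (v : seq 'I_b) (z : nat -> 'I_b) (th c : R) (B : nat) : Prop :=
  lam ^+ 2 < th <= 1 /\
  (forall x : R, 0 <= x < 1 -> 0 <= th * X (scat v z) x + c < B%:R).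

Definition rescaled (v : seq 'I_b) (z : nat -> 'I_b) (th c : R) (x : R) : R :=
  th * X (scat v z) x + c.

Lemma avg_bad_cat (d eta r : R) l N :
  (forall n, (N <= n)%N -> avg n (fun w => ind (badw d eta r w)) <= eta) ->
  forall n, (N <= n)%N -> avg n (fun v => avg l (fun w => ind (badw d eta r (w ++ v)))) <= eta.
Proof.
move=> h n Nn; rewrite avg_exch -(avg_cat l n (fun w => ind (badw d eta r w))).
by apply: h; rewrite (leq_trans Nn)// leq_addl.
Qed.

Lemma binv_cvg0 : (fun m => (b%:R^-1 : R) ^+ m) @ \oo --> 0.
Proof. exact: expr_cvg0. Qed.

Lemma binvX_gt0 m : 0 < (b%:R^-1 : R) ^+ m.
Proof. by rewrite exprn_gt0// invr_gt0. Qed.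

(** [E i v] bounds the proportion of copies at level [i] that cross a boundary or are atypical. It
    depends on [v] alone, so it can be averaged before z, th and c are known. The scale [r0] and the
    depth [q] are fixed before [m]. *)
Lemma core_lower e1 : 0 < e1 -> exists al', [/\ 0 <= al' <= al, al - e1 <= al' &
  exists M, forall m, (M <= m)%N -> exists E : nat -> seq 'I_b -> R,
  [/\ forall i v, 0 <= E i v,
     forall i, exists N, forall n, (N <= n)%N -> al' * avg n (E i) <= e1 &
     forall v z th c B, admissible v z th c B -> forall i, exists a : nat -> R,
      [/\ forall s, 0 <= a s <= pc (b := b) (rescaled v z th c) i s,
         forall s, a s * al' <= pc (b := b) (rescaled v z th c) i s *
             (Hl (b := b) (rescaled v z th c) i m s / (m%:R * ln b%:R)) &
         1 - E i v <= \sum_(s < B * b ^ i) a s]]].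
Proof.
move=> e10; have al0 := al_ge0; have [ale|eal] := leP al e1.
  (* Here nonnegativity of entropy is enough. In the other case al > 0, so that small balls are
     light and crossings can be controlled. *)
  exists 0; split; [by rewrite lexx|by rewrite subr_le0|].
  exists 0%N => m _; exists (fun _ _ => 1); split => //.
    by move=> i; exists 0%N => n _; rewrite mul0r ltW.
  move=> v z th c B [thb G0] i; exists (fun=> 0); split.
  - by move=> s; rewrite lexx pc_ge0.
  - move=> s; rewrite mulr0; apply: mulr_ge0; first exact: pc_ge0.
    apply: divr_ge0; last by rewrite mulr_ge0// ltW.
    exact: (Hl_ge0 b2 (mG v z th c) G0).
  - by rewrite subrr big1.
have al1 : 0 < al by apply: lt_trans eal.
pose d := e1 / 4.
have d0 : 0 < d by rewrite divr_gt0.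
have dal : 0 < al - d by rewrite subr_gt0 /d; lra.
pose Dn : R := (Num.truncn (2 * C + 3)).*2.+1%:R.
have Dn1 : 1 <= Dn by rewrite ler1n.
(* The three terms of [E] average to at most (2 + 2 Dn) eta, and [al] times this is below e1 / 2. *)
pose eta := e1 / (4 * al * (2 + Dn)).
have eta0 : 0 < eta by rewrite divr_gt0// !mulr_gt0// addr_gt0// (lt_le_trans ltr01).
have aleta : al * ((2 + Dn) * eta) = e1 / 4.
  by rewrite /eta; field; rewrite !gt_eqF// addr_gt0// (lt_le_trans ltr01).
have [M1 hM1] := bad_avg binvX_gt0 binv_cvg0 d0 eta0.
have [|M2 hM2] := @expr_small R (expR (- (al - d) * ln b%:R)) eta _ eta0.
- by rewrite expR_ge0/= -[X in _ < X]expR0 ltr_expR mulNr oppr_lt0 mulr_gt0.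
pose m0 := maxn M1 M2.
pose r0 : R := b%:R^-1 ^+ m0.
have r00 : 0 < r0 by exact: binvX_gt0.
have rho2 : eta + expR ((al - d) * ln r0) <= 2 * eta.
  rewrite mulr_natl mulr2n lerD2l (_ : (al - d) * ln r0 = m0%:R * (- (al - d) * ln b%:R)).
    by rewrite expRM_natl hM2// leq_maxr.
  by rewrite /r0 lnXn ?invr_gt0// lnV// -mulr_natl; ring.
have [N1 hN1] := hM1 m0 (leq_maxl _ _).
have lam01 : 0 <= lam < 1 by rewrite lam1 ltW.
(* 24 in place of the 12 of [crossing_bound] yields the strict inequality. *)
have [|q1 hq1] := @expr_small R lam (lam ^+ 3 * r0 / (24 * C)) lam01.
  by rewrite divr_gt0// mulr_gt0// exprn_gt0.
have [|q2 hq2] := @expr_small R lam (2 * C)^-1 lam01.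
  by rewrite invr_gt0 mulr_gt0.
pose q := maxn q1 q2.
have hqa : 12 * C * lam ^+ q < lam ^+ 3 * r0.
  have := hq1 q (leq_maxl _ _); rewrite ler_pdivlMr ?mulr_gt0// => h.
  have : 0 < lam ^+ 3 * r0 by rewrite mulr_gt0// exprn_gt0.
  by move: h; set u := lam ^+ 3 * r0; set w := lam ^+ q; nra.
have hqb : 2 * C * lam ^+ q <= 1.
  have := hq2 q (leq_maxr _ _).
  by rewrite -[X in _ <= X -> _]mul1r ler_pdivlMr ?mulr_gt0// mulrC.
pose Kq : R := 3 * lam ^- (q + 3).
have Kq0 : 0 < Kq by rewrite mulr_gt0// invr_gt0 exprn_gt0.
pose r (m : nat) : R := 3 * lam ^- (q + 3) * b%:R^-1 ^+ m.
have r_gt0 m : 0 < r m by rewrite /r mulr_gt0//; exact: binvX_gt0.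
have rcv : r @ \oo --> 0.
  rewrite -(mulr0 Kq); apply: cvgM; [exact: cvg_cst|exact: binv_cvg0].
have [M3 hM3] := bad_avg r_gt0 rcv d0 eta0.
pose K := ln Kq.
have K0 : 0 <= K.
  rewrite ln_ge0// /Kq -[X in X <= _]mulr1; apply: ler_pM => //; first by rewrite ler1n.
  by rewrite invf_ge1 ?exprn_gt0// exprn_ile1// ltW.
exists (al - e1); split.
- by rewrite subr_ge0 ltW//= gerBl ltW.
- by [].
(* The second bound makes [K], the logarithm of the constant in [r m], at most e1 / (4 al) times m
   ln b. *)
exists (maxn M3 (Num.truncn (K * 4 * al / (e1 * ln b%:R))).+1) => m.
rewrite geq_max => /andP[mM3 mM4].
have [N3 hN3] := hM3 m mM3.
have e1l : 0 < e1 * ln b%:R by rewrite mulr_gt0.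
have KL : 4 * al * K <= e1 * (m%:R * ln b%:R).
  have h0 : 0 <= K * 4 * al / (e1 * ln b%:R) by rewrite divr_ge0 ?(ltW e1l)// !mulr_ge0// ltW.
  have /andP[_ h] := truncn_itv h0.
  have : K * 4 * al / (e1 * ln b%:R) <= m%:R by apply: (le_trans (ltW h)); rewrite ler_nat.
  rewrite ler_pdivrMr// => h'; move: h'; rewrite (_ : 4 * al * K = K * 4 * al); last by ring.
  by move=> h'; apply: (le_trans h'); rewrite le_eqVlt; apply/orP; left; apply/eqP; ring.
have m0lt : (0 < m)%N by apply: leq_trans mM4.
set L := m%:R * ln b%:R in KL *.
have L0 : 0 < L by rewrite mulr_gt0// ltr0n.
have lnr : ln (r m) = K - L.
  rewrite /r lnM ?posrE//; last exact: binvX_gt0.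
  by rewrite ln_binvX.
have ale4 : al * eta <= e1 / 4.
  rewrite -aleta ler_pM2l// ler_peMl ?(ltW eta0)//; lra.
have KLe : K <= L.
  have : 4 * al * K <= al * L by apply: (le_trans KL); rewrite ler_pM2r// ltW.
  have -> : 4 * al * K = al * (4 * K) by ring.
  rewrite ler_pM2l//; lra.
pose tau : R := expR ((al - d) * ln (r m)).
have t01 : 0 < tau <= 1.
  rewrite expR_gt0 -[X in _ <= X]expR0 ler_expR lnr mulr_ge0_le0//; [exact: ltW|by rewrite subr_le0].
(* The first two terms account for crossings, the third for atypical copies. *)
exists (fun i v => avg (projT1 (level i)) (fun w => ind (badw d eta r0 (w ++ v))) + Dn * (2 * eta) +
    avg (q + projT1 (level i)) (fun w => ind (badw d eta (r m) (w ++ v)))).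
have aleta0 : 0 <= al * eta by rewrite mulr_ge0// ltW.
have Dneta0 : 0 <= Dn * (2 * eta).
  by rewrite mulr_ge0 ?(le_trans ler01 Dn1)// mulr_ge0// ltW.
split.
- move=> i v; apply: addr_ge0; [apply: addr_ge0 => //|];
  by apply: avg_ge0 => // w _; exact: ind_ge0.
- move=> i; exists (maxn N1 N3) => n; rewrite geq_max => /andP[n1 n3].
  rewrite !avgD (avg_cst b2).
  have h1 := avg_bad_cat (projT1 (level i)) hN1 n1.
  have h3 := avg_bad_cat (q + projT1 (level i)) hN3 n3.
  apply: (@le_trans _ _ ((al - e1) * (eta + Dn * (2 * eta) + eta))).
    by rewrite ler_wpM2l ?subr_ge0 ?(ltW eal)// !lerD.
  apply: (@le_trans _ _ (al * (eta + Dn * (2 * eta) + eta))).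
    rewrite ler_wpM2r ?gerBl ?(ltW e10)//.
    by apply: addr_ge0; [apply: addr_ge0 => //; exact: ltW|exact: ltW].
  have -> : al * (eta + Dn * (2 * eta) + eta) = 2 * (al * ((2 + Dn) * eta)) - 2 * (al * eta) by ring.
  rewrite aleta; lra.
move=> v z th c B [thb G0] i.
move: (level i) => [l hl]; rewrite [projT1 _]/=.
exists (acount (b := b) (rescaled v z th c) (q + l) i m tau eta); split.
- move=> s; rewrite (acount_le b2 (mG v z th c))// andbT.
  by apply: avg_ge0 => // w _; exact: ind_ge0.
- move=> s.
  have eta1 : eta <= 1.
    have : al * eta <= al * 1 by rewrite mulr1; apply: (le_trans ale4); lra.
    by rewrite ler_pM2l.
  have := lower b2 (mG v z th c) G0 (q + l) i m t01 s eta1.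
  have a0 : 0 <= acount (b := b) (rescaled v z th c) (q + l) i m tau eta s.
    by apply: avg_ge0 => // w _; exact: ind_ge0.
  rewrite mulrA ler_pdivlMr// => h; apply: le_trans h.
  rewrite -mulrA ler_wpM2l// /tau expRK lnr.
  have -> : - ((al - d) * (K - L)) = (al - d) * (L - K) by ring.
  rewrite [leRHS]mulrA.
  (* The loss e1 is spent as e1/4 on [d], e1/4 on the proportion [eta], and the rest on [K]. *)
  apply: (@le_trans _ _ ((al - d - e1 / 4) * (L - K))).
    have : 0 <= al * K by rewrite mulr_ge0// ltW.
    have : 0 <= e1 * K by rewrite mulr_ge0// ltW.
    have : 0 <= e1 * L by rewrite mulr_ge0// ltW.
    rewrite /d; lra.
  rewrite ler_wpM2r ?subr_ge0//.
  have : 0 <= d * eta by rewrite mulr_ge0// ltW.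
  move: ale4; rewrite mulrBl mul1r mulrBr [eta * al]mulrC [eta * d]mulrC; lra.
have := @acount_sum R b b2 (rescaled v z th c) B G0 (q + l) i m tau eta _ (erefl (B * b ^ i)%N).
move=> h; apply: le_trans h; rewrite -[leRHS]addrA -opprD lerB//; apply: lerD.
  have cb := crossing_bound thb G0 hl d r00 (ltW eta0) hqa hqb.
  apply: le_trans cb _.
  by rewrite lerD2l ler_wpM2l.
apply: avg_le => w wq; apply: ind_mono => nw; apply: contrapT => nb.
by apply: nw; exact: (wgood_of_good thb G0 hl wq nb).
Qed.

Lemma core_upper e1 B : 0 < e1 -> exists T0, forall T, (T0 <= T)%N ->
  exists N, forall n, (N <= n)%N ->
  avg n (fun v => ind (exists z th c, admissible v z th c B /\
     T%:R * (al + e1) * ln b%:R < ent (b := b) (rescaled v z th c) B T)) <= e1.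
Proof.
move=> e10; have al0 := al_ge0.
have e40 : 0 < e1 / 4 by rewrite divr_gt0.
have [M hM] := bad_avg binvX_gt0 binv_cvg0 e40 e40.
(* The part of [ent_G_upper] that does not grow with T. It takes half of e1 T ln b; the dimension
   error and the bad cells take a quarter each. *)
pose c1 : R := ln 14 + e1 / 4 * (ln 2 + ln B%:R).
have e1l : 0 < e1 / 2 * ln b%:R by rewrite mulr_gt0// divr_gt0.
exists (maxn M (Num.truncn (c1 / (e1 / 2 * ln b%:R))).+1) => T.
rewrite geq_max => /andP[TM Tc]; have [N hN] := hM T TM.
exists N => n Nn; apply: (@le_trans _ _ (e1 / 4)); last by lra.
apply: le_trans (hN n Nn); apply: avg_le => v _; apply: ind_mono.
move=> [z [th [c [[thb G0] lt]]]]; apply: contrapT => nb.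
have al4 : 0 <= al + e1 / 4 by rewrite addr_ge0// ltW.
have := ent_G_upper thb G0 al4 nb; rewrite -/(rescaled v z th c).
apply/negP; rewrite -ltNge; apply: le_lt_trans lt.
have B0 : (0 < B)%N.
  by case: (B) G0 => // /(_ 0 x001)/andP[h h']; have := le_lt_trans h h'; rewrite ltxx.
rewrite natrM lnM ?posrE ?ltr0n// ?expn_gt0 ?(leq_trans _ b2)//.
rewrite natrX lnXn// (_ : ln b%:R *+ T = T%:R * ln b%:R); last by rewrite mulr_natl.
have c1T : c1 <= e1 / 2 * (T%:R * ln b%:R).
  have : c1 / (e1 / 2 * ln b%:R) <= T%:R.
    have [c10|/ltW c10] := leP 0 (c1 / (e1 / 2 * ln b%:R)); last by apply: le_trans c10 _.
    by have /andP[_ h] := truncn_itv c10; rewrite (le_trans (ltW h))// ler_nat.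
  by rewrite ler_pdivrMr// mulrCA.
move: c1T; rewrite /c1.
have -> : T%:R * (al + e1 / 4) * ln b%:R = (al + e1 / 4) * (T%:R * ln b%:R) by ring.
have -> : T%:R * (al + e1) * ln b%:R = (al + e1) * (T%:R * ln b%:R) by ring.
set L := T%:R * ln b%:R; rewrite !mulrDl !mulrDr; lra.
Qed.

(** [entropy_porous] in terms of cell masses, after a rescaling that moves level t + n to level
    0. *)
Definition gporous (G : R -> R) (eps : R) (m k : nat) : Prop :=
  1 - eps < k%:R^-1 * \sum_(1 <= i < k.+1) prob [set x |
    0 < pc (b := b) G i (cell (b := b) G i x) /\
    m%:R^-1 * (Hl (b := b) G i m (cell (b := b) G i x) / ln b%:R) < al + eps].

Lemma core_porous eps B : 0 < eps -> exists M, forall m, (M <= m)%N ->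
  exists K, forall k, (K <= k)%N -> exists N, forall n, (N <= n)%N ->
  avg n (fun v => ind (exists z th c, admissible v z th c B /\
    ~ gporous (rescaled v z th c) eps m k)) <= eps / 2.
Proof.
move=> eps0; have al0 := al_ge0.
pose h1 : R := eps ^+ 2 / 4.
have h10 : 0 < h1 by rewrite divr_gt0// exprn_gt0.
(* The three bounds serve the final estimate 3 e1 + h1 < eps^2, the exceptional words of
   [core_upper], and Markov's inequality with h1^-1 e1 <= eps / 4. *)
pose e1 : R := Num.min (eps ^+ 2 / 8) (Num.min (eps / 4) (eps * h1 / 4)).
have e10 : 0 < e1.
  by rewrite !lt_min !divr_gt0// ?mulr_gt0// exprn_gt0.
have e1a : e1 <= eps ^+ 2 / 8 by rewrite ge_min lexx.
have e1b : e1 <= eps / 4 by rewrite !ge_min lexx orbT.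
have e1c : e1 <= eps * h1 / 4 by rewrite !ge_min lexx !orbT.
have [al' [/andP[al'0 al'1] al'2 [M hM]]] := core_lower e10.
have [T0 hT0] := core_upper B e10.
exists M.+1 => m Mm; have [E [E0 Eavg Elow]] := hM m (ltnW Mm).
have m0 : (0 < m)%N by apply: leq_trans Mm.
(* Ensures m (al + e1) <= k e1: the entropy is taken at level k + m but divided by k. *)
exists (maxn T0 (Num.truncn (m%:R * (al + e1) / e1)).+1) => k.
rewrite geq_max => /andP[kT km].
have k0 : (0 < k)%N by apply: leq_trans km.
have k0' : 0 < k%:R :> R by rewrite ltr0n.
have [N1 hN1] := hT0 (k + m)%N (leq_trans kT (leq_addr _ _)).
(* The threshold for [E i] depends on the level; a common one exists for the levels up to [k]. *)
have [N2 hN2] : exists N, forall n, (N <= n)%N -> forall i, (i < k.+1)%N -> al' * avg n (E i) <= e1.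
  elim: k.+1 => [|k' [N' hN']]; first by exists 0%N.
  have [N'' hN''] := Eavg k'; exists (maxn N' N'') => n; rewrite geq_max => /andP[a1 a2] i.
  by rewrite ltnS leq_eqVlt => /predU1P[->|ik]; [exact: hN''|exact: hN'].
exists (maxn N1 N2) => n; rewrite geq_max => /andP[n1 n2].
pose ebar v := k%:R^-1 * \sum_(1 <= i < k.+1) al' * E i v.
have ebar0 v : 0 <= ebar v.
  by rewrite mulr_ge0 ?invr_ge0// sumr_ge0// => i _; rewrite mulr_ge0.
have ebar_avg : avg n ebar <= e1.
  rewrite avgZ avg_sum ler_pdivrMl//.
  apply: (@le_trans _ _ (\sum_(1 <= i < k.+1) e1)).
    rewrite big_nat [leRHS]big_nat; apply: ler_sum => i /andP[_ ik].
    by rewrite avgZ hN2.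
  by rewrite sumr_const_nat subSS subn0 mulr_natl.
apply: (@le_trans _ _ (avg n (fun v => ind (exists z th c, admissible v z th c B /\
     (k + m)%:R * (al + e1) * ln b%:R < ent (b := b) (rescaled v z th c) B (k + m)) + ind (h1 < ebar v)))); last first.
  rewrite avgD; apply: (@le_trans _ _ (e1 + h1^-1 * e1)).
    apply: lerD; first exact: hN1.
    apply: le_trans (@avg_markov R b n ebar h1 h10 (fun w _ => ebar0 w)) _.
    by rewrite ler_wpM2l// invr_ge0 ltW.
  have : h1^-1 * e1 <= eps / 4 by rewrite ler_pdivrMl// mulrCA mulrA.
  by set u := h1^-1 * e1; lra.
apply: avg_le => v _; apply: le_trans (ind_or _ _); apply: ind_mono.
move=> [z [th [c [adm np]]]]; apply: contrapT => /not_orP[nup nebar]; apply: np.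
have upk : ent (b := b) (rescaled v z th c) B (k + m) <= (k + m)%:R * (al + e1) * ln b%:R.
  by rewrite leNgt; apply/negP => h; apply: nup; exists z, th, c.
have eb : ebar v <= h1 by rewrite leNgt; apply/negP.
have [thb G0] := adm; set G := rescaled v z th c in upk *.
have mGG : measurable_fun setT G := mG v z th c.
pose L := m%:R * ln b%:R : R.
have L0 : 0 < L by rewrite mulr_gt0// ltr0n.
pose high i := \sum_(s < B * b ^ i) ind (al + eps <= Hl (b := b) G i m s / L) * pc (b := b) G i s.
have highE i : eps * high i <= (ent (b := b) G B (i + m) - ent (b := b) G B i) / L - al' + al' * E i v.
  have [a [ap alow asum]] := Elow v z th c B adm i.
  have := @high_mass R 'I_(B * b ^ i) (fun s => pc (b := b) G i s) (fun s => a s)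
     (fun s => Hl (b := b) G i m s / L) al' al eps (E i v).
  rewrite -/(high i) [E i v * al']mulrC.
  have -> : \sum_(s < B * b ^ i) pc (b := b) G i s * (Hl (b := b) G i m s / L) =
     (ent (b := b) G B (i + m) - ent (b := b) G B i) / L.
    by rewrite -(ent_chain b2 mGG G0) mulr_suml; apply: eq_bigr => s _; rewrite mulrA.
  apply => //.
  - by move=> s; rewrite divr_ge0 ?(ltW L0)//; exact: (Hl_ge0 b2 mGG G0).
  - exact: (pc_sum b2 mGG G0).
  - by rewrite al'0.
have lowp i : 1 - high i <= prob [set x |
    0 < pc (b := b) G i (cell (b := b) G i x) /\
    m%:R^-1 * (Hl (b := b) G i m (cell (b := b) G i x) / ln b%:R) < al + eps].
  rewrite (prob_cells b2 mGG G0 i (fun s => 0 < pc (b := b) G i s /\ m%:R^-1 * (Hl (b := b) G i m s / ln b%:R) < al + eps)).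
  rewrite lerBlDr -big_split/= -[X in X <= _](pc_sum b2 mGG G0 i); apply: ler_sum => s _.
  rewrite -mulrDl; have := pc_ge0 (b := b) G i s; rewrite le_eqVlt => /predU1P[<-|p0].
    by rewrite mulr0.
  rewrite -[X in X <= _]mul1r ler_pM2r//.
  have [hi|lo] := leP (al + eps) (Hl (b := b) G i m s / L).
    by rewrite (@ind1 _ (is_true true))// lerDr ind_ge0.
  rewrite ind1 ?lerDl ?ind_ge0//; split => //; apply: le_lt_trans lo.
  by rewrite /L invfM [_ * (_ / _)]mulrCA.
rewrite /gporous; apply: (@lt_le_trans _ _ (k%:R^-1 * \sum_(1 <= i < k.+1) (1 - high i))); last first.
  by rewrite ler_pM2l ?invr_gt0//; apply: ler_sum => i _; exact: lowp.
rewrite sumrB sumr_const_nat subSS subn0 mulrBr mulVf ?gt_eqF// ltrD2l ltrN2.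
rewrite -(ltr_pM2l eps0) mulrCA mulr_sumr.
apply: (@le_lt_trans _ _ (k%:R^-1 * \sum_(1 <= i < k.+1) ((ent (b := b) G B (i + m) - ent (b := b) G B i) / L - al' + al' * E i v))).
  by rewrite ler_pM2l ?invr_gt0//; apply: ler_sum => i _; exact: highE.
rewrite !big_split/= -mulr_suml sumr_const_nat subSS subn0 !mulrDr -/(ebar v) -[- al' *+ k]mulr_natl mulKf ?gt_eqF//.
have tel : k%:R^-1 * ((\sum_(1 <= i < k.+1) (ent (b := b) G B (i + m) - ent (b := b) G B i)) / L) <= al + 2 * e1.
  rewrite ler_pdivrMl// ler_pdivrMr//.
  apply: (le_trans (ent_telescope b2 mGG G0 k m)).
  rewrite /L mulrCA ler_pM2l ?ltr0n//; apply: (le_trans upk).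
  rewrite ler_pM2r// natrD mulrDl.
  have : m%:R * (al + e1) <= k%:R * e1.
    have h : 0 <= m%:R * (al + e1) / e1 by rewrite divr_ge0 ?(ltW e10)// mulr_ge0// addr_ge0// ltW.
    have /andP[_ h'] := truncn_itv h; rewrite -ler_pdivrMr// (le_trans (ltW h'))// ler_nat//.
  by rewrite !mulrDr; lra.
have h1e : h1 = eps * eps / 4 by rewrite /h1 expr2.
have e1a' : e1 <= eps * eps / 8 by rewrite -expr2.
have ee : 0 < eps * eps by rewrite mulr_gt0.
move: tel eb al'2 h1e e1a' ee; set t1 := _^-1 * _; set t2 := ebar v; set t3 := eps * eps; lra.
Qed.

End Core.

(** * Termwise integration of geometrically bounded series *)

Section GeometricSeries.
Context {R : realType}.
Implicit Types (u : R ^nat) (K q : R).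

(** The subtracted power makes the bound the exact geometric sum, so the induction closes. The [l]
    vanishing terms will come from a common prefix of two sequences. *)
Lemma geo_partial u K q l : 0 <= q < 1 -> 0 <= K ->
  (forall n, (n < l)%N -> u n = 0) -> (forall n, `|u n| <= K * q ^+ n) ->
  forall N, \sum_(0 <= n < N) `|u n| <= K * (q ^+ l - q ^+ maxn N l) / (1 - q).
Proof.
move=> /andP[q0 q1] K0 u0 uK; have q1' : 0 < 1 - q by rewrite subr_gt0.
elim=> [|N IH]; first by rewrite big_nil max0n subrr mulr0 mul0r.
rewrite big_nat_recr//=; have [Nl|lN] := ltnP N l.
  by rewrite (u0 N Nl) normr0 addr0 (maxn_idPr Nl); rewrite (maxn_idPr (ltnW Nl)) in IH.
rewrite (maxn_idPl (leqW lN)); rewrite (maxn_idPl lN) in IH.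
apply: (le_trans (lerD IH (uK N))); rewrite le_eqVlt; apply/orP; left; apply/eqP.
by rewrite exprS; field; rewrite gt_eqF.
Qed.

Lemma geo_cvg u K q : 0 <= q < 1 -> (forall n, `|u n| <= K * q ^+ n) -> cvgn (series u).
Proof.
move=> /andP[q0 q1] uK; apply: normed_cvg; apply: (@series_le_cvg R _ (geometric K q)).
- by move=> n; rewrite /= normr_ge0.
- by move=> n; apply: le_trans (uK n).
- by move=> n; exact: uK.
- by apply: is_cvg_geometric_series; rewrite ger0_norm.
Qed.

Lemma geo_tail u K q l : 0 <= q < 1 -> 0 <= K ->
  (forall n, (n < l)%N -> u n = 0) -> (forall n, `|u n| <= K * q ^+ n) ->
  `|limn (series u)| <= K * q ^+ l / (1 - q).
Proof.
move=> q01 K0 u0 uK; have cu := geo_cvg q01 uK.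
have B N : `|series u N| <= K * q ^+ l / (1 - q).
  apply: le_trans (ler_norm_sum _ _ _) _; apply: le_trans (geo_partial q01 K0 u0 uK N) _.
  case/andP: q01 => q0 q1; rewrite ler_wpM2r ?invr_ge0 ?subr_ge0 ?(ltW q1)// ler_wpM2l//.
  by rewrite gerBl exprn_ge0.
rewrite ler_norml; apply/andP; split.
  by apply: limr_ge => //; apply: nearW => N; have := B N; rewrite ler_norml => /andP[].
by apply: limr_le => //; apply: nearW => N; have := B N; rewrite ler_norml => /andP[].
Qed.

Lemma lim_series_recl u : cvgn (series u) ->
  limn (series u) = u 0%N + limn (series (fun n => u n.+1)).
Proof.
move=> cu.
have e : (fun N => series u N.+1) = (fun N => u 0%N + series (fun n => u n.+1) N).
  by apply/funext => N; rewrite /series/= big_nat_recl.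
have c1 : (fun N => series u N.+1) @ \oo --> limn (series u) by rewrite cvg_shiftS.
have c2 : cvgn (series (fun n => u n.+1)).
  apply/cvg_ex; exists (limn (series u) - u 0%N).
  have -> : series (fun n => u n.+1) = (fun N => series u N.+1 - u 0%N).
    by apply/funext => N; rewrite (congr1 (fun f => f N) e)/= addrAC subrr add0r.
  by apply: cvgB => //; exact: cvg_cst.
rewrite -[LHS](cvg_lim _ c1)//; apply: cvg_lim => //.
by rewrite e; apply: cvgD => //; exact: cvg_cst.
Qed.

Lemma lim_series_scale u (k : R) : cvgn (series u) ->
  limn (series (fun n => k * u n)) = k * limn (series u).
Proof. exact: lim_seriesZ. Qed.

End GeometricSeries.

(** * The fundamental theorem of calculus for piecewise smooth functions *)

Section PiecewiseFTC.
Context {R : realType}.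
Notation mu := (@lebesgue_measure R).
Implicit Types (h g : R -> R).

(** A derivative in integrated form, insensitive to the values of [g] at break points. Measurability
    and boundedness are carried along for gluing, sums and dominated convergence. *)
Definition pw_deriv h g (p q : R) : Prop :=
  [/\ measurable_fun `[p, q] g, exists L, forall t, p <= t <= q -> `|g t| <= L &
      \int[mu]_(t in `[p, q]) g t = h q - h p].

Lemma bounded_integrable g (p q L : R) : measurable_fun `[p, q] g ->
  (forall t, p <= t <= q -> `|g t| <= L) -> mu.-integrable `[p, q] (EFin \o g).
Proof.
move=> mg gL; apply: measurable_bounded_integrable => //.
  exact: (compact_finite_measure (@segment_compact R p q)).
exists L; split; first exact: num_real.
by move=> M LM t /=; rewrite in_itv/= => /gL tL; apply: (le_trans tL); exact: ltW.
Qed.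

Lemma pw_integrable h g p q : pw_deriv h g p q -> mu.-integrable `[p, q] (EFin \o g).
Proof. by case=> mg [L gL] _; exact: bounded_integrable gL. Qed.

Lemma pw_glue h g (p q r : R) : p <= q -> q <= r ->
  pw_deriv h g p q -> pw_deriv h g q r -> pw_deriv h g p r.
Proof.
move=> pq qr [m1 [L1 b1] i1] [m2 [L2 b2] i2].
have m12 : measurable_fun `[p, r] g.
  rewrite (@itv_bndbnd_setU _ _ (BLeft p) (BLeft q)) ?bnd_simp//.
  apply/measurable_funU => //; split=> //.
  by apply: measurable_funS m1 => //; apply: subset_itvl; rewrite bnd_simp.
have b12 t : p <= t <= r -> `|g t| <= Num.max L1 L2.
  move=> /andP[pt tr]; rewrite le_max; have [tq|/ltW qt] := leP t q.
    by rewrite b1 ?pt.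
  by rewrite [X in _ || X]b2 ?qt ?orbT.
split => //; first by exists (Num.max L1 L2).
have ig := bounded_integrable m12 b12.
have := @Rintegral_itvB R g (BLeft p) (BRight r) q ig.
rewrite !bnd_simp => /(_ pq qr); rewrite i1 => e.
have -> : \int[mu]_(t in `[p, r]) g t = \int[mu]_(t in `]q, r]) g t + (h q - h p).
  by rewrite -e subrK.
rewrite Rintegral_itv_obnd_cbnd; last first.
  by apply: integrableS ig => //; apply: subset_itvr; rewrite bnd_simp.
by rewrite i2; ring.
Qed.

Lemma pw_piece h g (psi dpsi : R -> R) (p q : R) : p <= q ->
  (forall x : R, is_derive x 1 psi (dpsi x)) -> continuous dpsi ->
  (forall x, p <= x <= q -> h x = psi x) -> (forall x, p < x < q -> g x = dpsi x) ->
  pw_deriv h g p q.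
Proof.
move=> pq dp cd hp gd.
have mg : measurable_fun `[p, q] g.
  apply/measurable_fun_itv_bndo_bndcP/measurable_fun_itv_obnd_cbndP.
  apply: (@eq_measurable_fun _ _ _ _ _ dpsi).
    by move=> x; rewrite inE/= in_itv/= => /gd.
  apply: measurable_funTS; exact: continuous_measurable_fun.
have cdpq : {within `[p, q], continuous dpsi}.
  by apply: continuous_subspaceT.
have [L hL] : exists L, forall t, p <= t <= q -> `|g t| <= L.
  have cn : {within `[p, q], continuous (fun x => `|dpsi x|)}.
    by apply: continuous_subspaceT => x; apply: continuous_comp; [exact: cd|exact: norm_continuous].
  have [c cpq hc] := EVT_max pq cn.
  (* At the two end points [g] is unrelated to [dpsi]. *)
  exists (Num.max `|dpsi c| (Num.max `|g p| `|g q|)) => t /andP[pt tq].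
  rewrite !le_max; move: pt; rewrite le_eqVlt => /predU1P[<-|pt]; first by rewrite lexx !orbT.
  move: tq; rewrite le_eqVlt => /predU1P[->|tq]; first by rewrite lexx !orbT.
  by rewrite gd ?pt// hc// in_itv/= !ltW.
split => //; first by exists L.
have := pq; rewrite le_eqVlt => /predU1P[<-|pq'].
  by rewrite set_itv1 Rintegral_set1 subrr.
have ig := bounded_integrable mg hL.
have igo : mu.-integrable `]p, q] (EFin \o g).
  by apply: integrableS ig => //; apply: subset_itvr; rewrite bnd_simp.
have igoo : mu.-integrable `]p, q[ (EFin \o g).
  by apply: integrableS igo => //; apply: subset_itvl; rewrite bnd_simp.
have ic : mu.-integrable `[p, q] (EFin \o dpsi).
  by apply: continuous_compact_integrable => //; exact: segment_compact.
have ico : mu.-integrable `]p, q] (EFin \o dpsi).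
  by apply: integrableS ic => //; apply: subset_itvr; rewrite bnd_simp.
have icoo : mu.-integrable `]p, q[ (EFin \o dpsi).
  by apply: integrableS ico => //; apply: subset_itvl; rewrite bnd_simp.
have -> : \int[mu]_(t in `[p, q]) g t = \int[mu]_(t in `[p, q]) dpsi t.
  rewrite -!Rintegral_itv_obnd_cbnd// -!Rintegral_itv_bndo_bndc//.
  by apply: eq_Rintegral => x; rewrite inE/= in_itv/= => /gd.
rewrite /Rintegral (@continuous_FTC2 _ dpsi psi)//=.
- by rewrite !hp ?lexx ?pq//.
- have cp x : {for x, continuous psi}.
    by apply/differentiable_continuous/derivable1_diffP; case: (dp x).
  split.
  + by move=> x _; case: (dp x).
  + exact/cvg_at_right_filter/cp.
  + exact/cvg_at_left_filter/cp.
- by move=> x _; rewrite derive1E; case: (dp x).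
Qed.

Lemma pw_chain h g (N : nat) (a : nat -> R) (psi dpsi : nat -> R -> R) :
  (forall k, (k < N)%N -> a k < a k.+1) ->
  (forall k, (k < N)%N -> [/\ forall x : R, is_derive x 1 (psi k) (dpsi k x),
     continuous (dpsi k), forall x, a k <= x <= a k.+1 -> h x = psi k x &
     forall x, a k < x < a k.+1 -> g x = dpsi k x]) ->
  (0 < N)%N ->
  forall p q, a 0%N <= p -> p <= q -> q <= a N -> pw_deriv h g p q.
Proof.
move=> a_inc hk; elim: N a_inc hk => [//|N IH] a_inc hk _ p q ap pq qa.
have piece u v : a N <= u -> u <= v -> v <= a N.+1 -> pw_deriv h g u v.
  move=> au uv va; have [d1 d2 d3 d4] := hk N (ltnSn N).
  apply: (pw_piece uv d1 d2).
    by move=> x /andP[? ?]; apply: d3; rewrite (le_trans au)//= (le_trans _ va).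
  by move=> x /andP[? ?]; apply: d4; rewrite (le_lt_trans au)//= (lt_le_trans _ va).
case: N IH a_inc hk piece qa => [|N] IH a_inc hk piece qa; first exact: piece.
have a_inc' k : (k < N.+1)%N -> a k < a k.+1 by move=> kN; apply: a_inc; exact: leqW.
have hk' k (kN : (k < N.+1)%N) := hk k (leqW kN).
have IH' := IH a_inc' hk' isT.
have [qN|/ltW Nq] := leP q (a N.+1); first exact: IH'.
have [Np|/ltW pN] := leP (a N.+1) p; first exact: piece.
by apply: (@pw_glue h g p (a N.+1) q) => //; [exact: IH'|exact: piece].
Qed.

Lemma pwZ h g p q (k : R) : pw_deriv h g p q ->
  pw_deriv (fun x => k * h x) (fun x => k * g x) p q.
Proof.
move=> pw; have [mg [L bg] ig] := pw; split.
- exact: measurable_funM.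
- by exists (`|k| * L) => t /bg tL; rewrite normrM ler_wpM2l.
- by rewrite RintegralZl//; [rewrite ig mulrBr|exact: pw_integrable pw].
Qed.

Lemma pwD h g h' g' p q : pw_deriv h g p q -> pw_deriv h' g' p q ->
  pw_deriv (fun x => h x + h' x) (fun x => g x + g' x) p q.
Proof.
move=> pw pw'; have [mg [L bg] ig] := pw; have [mg' [L' bg'] ig'] := pw'; split.
- exact: measurable_funD.
- exists (L + L') => t tpq; apply: le_trans (ler_normD _ _) _.
  by rewrite lerD// ?bg ?bg'.
- rewrite RintegralD//; [|exact: pw_integrable pw|exact: pw_integrable pw'].
  by rewrite ig ig'; ring.
Qed.

Lemma pw_sum (h g : nat -> R -> R) (p q : R) : p <= q ->
  (forall n, pw_deriv (h n) (g n) p q) -> forall N,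
  pw_deriv (fun x => \sum_(0 <= n < N) h n x) (fun x => \sum_(0 <= n < N) g n x) p q.
Proof.
move=> pq hg; elim=> [|N IH].
  have -> : (fun x => \sum_(0 <= n < 0) h n x) = (fun=> 0) by apply/funext => x; rewrite big_nil.
  have -> : (fun x => \sum_(0 <= n < 0) g n x) = (fun=> 0) by apply/funext => x; rewrite big_nil.
  split; [exact: measurable_cst|by exists 0 => t _; rewrite normr0|].
  by rewrite Rintegral_cst// mul0r subrr.
have -> : (fun x => \sum_(0 <= n < N.+1) h n x) = (fun x => \sum_(0 <= n < N) h n x + h N x).
  by apply/funext => x; rewrite big_nat_recr.
have -> : (fun x => \sum_(0 <= n < N.+1) g n x) = (fun x => \sum_(0 <= n < N) g n x + g N x).
  by apply/funext => x; rewrite big_nat_recr.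
exact: pwD.
Qed.

Lemma pw_lim (h g : nat -> R -> R) (S : R -> R) (p q L : R) : p <= q ->
  (forall n, pw_deriv (h n) (g n) p q) ->
  (forall n t, p <= t <= q -> `|g n t| <= L) ->
  (forall t, p <= t <= q -> g ^~ t @ \oo --> S t) ->
  (fun n => h n q - h n p) @ \oo --> \int[mu]_(t in `[p, q]) S t.
Proof.
move=> pq hg gL gS.
have mg n : measurable_fun `[p, q] (EFin \o g n).
  by apply/measurable_EFinP; case: (hg n).
have mS : measurable_fun `[p, q] S.
  apply: (@measurable_fun_cvg _ _ R _ g).
    by move=> n; case: (hg n).
  by move=> t /=; rewrite in_itv/= => /gS.
have A1 : {ae mu, forall t, `[p, q]%classic t -> (fun n => (EFin \o g n) t) @ \oo --> (EFin \o S) t}.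
  apply: aeW => t /=; rewrite in_itv/= => /gS gt.
  by apply/cvg_EFin; [exact: nearW|exact: gt].
have A2 : mu.-integrable `[p, q] (EFin \o cst L).
  apply: (@bounded_integrable _ _ _ `|L|); first exact: measurable_cst.
  by move=> t _ /=.
have A3 : {ae mu, forall t n, `[p, q]%classic t -> (`|(EFin \o g n) t| <= (EFin \o cst L) t)%E}.
  by apply: aeW => t n /=; rewrite in_itv/= => /gL; rewrite lee_fin.
have [iS _ cv] := @dominated_convergence _ _ R mu _ (measurable_itv _) _ _ _ mg (proj2 (measurable_EFinP _ _) mS) A1 A2 A3.
have -> : (fun n => h n q - h n p) = (fun n => \int[mu]_(t in `[p, q]) g n t).
  by apply/funext => n; case: (hg n).
apply: fine_cvg; rewrite fineK; first exact: cv.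
exact: integrable_fin_num.
Qed.

End PiecewiseFTC.

(** * The functions W, Gamma_j and X_j *)

Section Weierstrass.
Context {R : realType} {b : nat} (b2 : (2 <= b)%N).
Variables (lam : R) (phi : R -> R).
Hypothesis lam_bnd : b%:R^-1 < lam < 1.
Hypothesis phi_per : Zperiodic phi.
Hypothesis phi_cont : continuous phi.
Hypothesis phi_pw : piecewise_C2 phi.
Notation mu := (@lebesgue_measure R).

Let bR0 : 0 < b%:R :> R. Proof. by rewrite ltr0n (leq_trans _ b2). Qed.
Let lam0 : 0 < lam.
Proof. by case/andP: lam_bnd => h _; apply: le_lt_trans h; rewrite invr_ge0 ltW. Qed.
Let lam1 : lam < 1. Proof. by case/andP: lam_bnd. Qed.
Let lam01 : 0 <= lam < 1. Proof. by rewrite lam1 ltW. Qed.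
Let g : R := gam lam b.
Let g0 : 0 < g. Proof. by rewrite /g /gam invr_gt0 mulr_gt0. Qed.
Let g1 : g < 1.
Proof.
rewrite /g /gam invf_lt1 ?mulr_gt0// mulrC -ltr_pdivrMr// mul1r.
by case/andP: lam_bnd.
Qed.
Let g01 : 0 <= g < 1. Proof. by rewrite g1 ltW. Qed.

(** The substitution maps [0, x] into [0, 1], where the pieces of [phi] are given; the break points
    are pulled back along it. *)
Lemma phi_affine_pw (B c x : R) : 0 < B -> 0 <= c -> 0 <= x -> x / B + c <= 1 ->
  pw_deriv (fun t => phi (t / B + c)) (fun t => derive1 phi (t / B + c) / B) 0 x.
Proof.
move=> B0 c0 x0 xc; have [N [a [a0 aN ainc apsi]]] := phi_pw.
have N0 : (0 < N)%N by case: N aN {ainc apsi} => // e; move: (@oner_neq0 R); rewrite -e a0 eqxx.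
have ex k : exists psi : R -> R, (k < N)%N -> C2fun psi /\
    forall x, a k <= x <= a k.+1 -> psi x = phi x.
  have [kN|nkN] := pselect (k < N)%N; last by exists phi.
  by have [psi h] := apsi k kN; exists psi.
have /choice[psi hpsi] := ex.
have U (t y : R) : (B * (y - c) <= t) = (y <= t / B + c).
  by rewrite mulrC -ler_pdivlMr// lerBlDr.
have V (t y : R) : (t <= B * (y - c)) = (t / B + c <= y).
  by rewrite mulrC -ler_pdivrMr// lerBrDr.
apply: (@pw_chain _ _ _ N (fun k => B * (a k - c)) (fun k t => psi k (t / B + c))
   (fun k t => derive1 (psi k) (t / B + c) * B^-1)) => //.
- by move=> k kN; rewrite ltr_pM2l// ltrD2r ainc.
- move=> k kN; have [[d1 d2 d3] hp] := hpsi k kN; split.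
  + move=> t; apply: (@is_derive1_comp _ (psi k) (fun t => t / B + c)).
      by apply: DeriveDef => //; rewrite derive1E.
    have -> : (fun t : R => t / B + c) = (fun t => B^-1 *: t + c).
      by apply/funext => u; rewrite mulrC.
    by apply: is_derive_eq; rewrite addr0; exact: mulr1.
  + have cd : continuous (derive1 (psi k)).
      by move=> y; apply/differentiable_continuous/derivable1_diffP.
    move=> t; apply: cvgM; last exact: cvg_cst.
    have ct : (fun t : R => t / B + c) @ t --> t / B + c.
      apply: cvgD; last exact: cvg_cst.
      by apply: cvgM; [exact: cvg_id|exact: cvg_cst].
    exact: (cvg_comp _ _ ct (cd _)).
  + by move=> t; rewrite U V => /hp.
  + move=> t; rewrite !ltNge U V -!ltNge => /andP[t1 t2]; congr (_ / _).
    (* Around an interior point [phi] coincides with the piece, hence so do the derivatives. *)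
    rewrite !derive1E; apply: near_eq_derive.
    have : \forall y \near t / B + c, y \in `]a k, a k.+1[.
      by apply: near_in_itvoo; rewrite in_itv/= t1.
    apply: filterS => y; rewrite in_itv/= => /andP[y1 y2].
    by rewrite hp// !ltW.
- by rewrite U mul0r add0r a0.
- by rewrite V aN.
Qed.

Lemma dphi_bounded : exists L, 0 <= L /\ forall t, 0 <= t <= 1 -> `|derive1 phi t| <= L.
Proof.
have [|_ [L hL] _] := @phi_affine_pw 1 0 1 ltr01 (lexx 0) ler01 _.
  by rewrite divr1 addr0.
exists `|L|; split=> // t /hL; rewrite !divr1 addr0 => h; apply: (le_trans h); exact: ler_norm.
Qed.

Definition lipC : R := projT1 (cid dphi_bounded).

Lemma lipC_ge0 : 0 <= lipC.
Proof. by case: (projT2 (cid dphi_bounded)). Qed.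

Lemma dphi_le t : 0 <= t <= 1 -> `|derive1 phi t| <= lipC.
Proof. by case: (projT2 (cid dphi_bounded)) => _; apply. Qed.

Lemma phi_lip u v : 0 <= u -> u <= v -> v <= 1 -> `|phi v - phi u| <= lipC * (v - u).
Proof.
move=> u0 uv v1; have vu : 0 <= v - u by rewrite subr_ge0.
have pw := @phi_affine_pw 1 u (v - u) ltr01 u0 vu _.
rewrite divr1 subrK in pw; have {}pw := pw v1.
have [mg _] := pw; rewrite !divr1 subrK add0r => <-.
have ig := pw_integrable pw.
apply: le_trans (le_normr_Rintegral _ ig) _ => //.
apply: (@le_trans _ _ (\int[mu]_(t in `[0, (v - u)]) lipC)).
  apply: le_Rintegral => //.
  - exact: (integrable_norm ig).
  - apply: (@bounded_integrable _ _ _ _ lipC); first exact: measurable_cst.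
    by move=> t _; rewrite ger0_norm ?lipC_ge0.
  - move=> t /=; rewrite in_itv/= => /andP[t0 t1]; rewrite !divr1; apply: dphi_le.
    by rewrite addr_ge0//= -lerBrDr (le_trans t1)// lerD2r.
have E : mu `[0, v - u]%classic = (v - u)%:E.
  rewrite lebesgue_measure_itv/= lte_fin; case: ltP => [_|h]; first by rewrite oppr0 adde0.
  by congr (_%:E); apply/eqP; rewrite eq_le h vu.
by rewrite Rintegral_cst// ler_wpM2l ?lipC_ge0//= (congr1 fine E).
Qed.

Lemma phi_shift x n : phi (x + n%:R) = phi x.
Proof. by elim: n => [|n IH]; rewrite ?addr0// -natr1 addrA phi_per. Qed.

Definition supC : R := `|phi 0| + lipC.

Lemma phi_le x : `|phi x| <= supC.
Proof.
have H t : 0 <= t -> t <= 1 -> `|phi t| <= supC.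
  move=> t0 t1; rewrite -[phi t](subrK (phi 0)) addrC; apply: le_trans (ler_normD _ _) _.
  rewrite lerD2l; apply: le_trans (phi_lip (lexx 0) t0 t1) _.
  by rewrite subr0 ler_piMr// lipC_ge0.
have P y : 0 <= y -> `|phi y| <= supC.
  move=> y0; have /andP[h1 h2] := truncn_itv y0.
  rewrite -[y](subrK (Num.truncn y)%:R) phi_shift H ?subr_ge0//.
  by rewrite lerBlDr addrC natr1 ltW.
have [x0|/ltW x0] := leP 0 x; first exact: P.
have nx : 0 <= - x by rewrite oppr_ge0.
rewrite -(phi_shift x (Num.truncn (- x)).+1); apply: P.
by have /andP[_ h] := truncn_itv nx; rewrite addrC -lerBlDr sub0r ltW.
Qed.

Lemma supC_ge0 : 0 <= supC. Proof. by rewrite addr_ge0// lipC_ge0. Qed.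

Let wterm (x : R) (n : nat) : R := lam ^+ n * phi (b%:R ^+ n * x).

Lemma wterm_le x n : `|wterm x n| <= supC * lam ^+ n.
Proof. by rewrite /wterm normrM (gtr0_norm (exprn_gt0 _ lam0)) mulrC ler_wpM2r ?phi_le// exprn_ge0// ltW. Qed.

Lemma WfunE x : Wfun lam b phi x = limn (series (wterm x)). Proof. by []. Qed.

Lemma W_cvg x : cvgn (series (wterm x)).
Proof. exact: geo_cvg lam01 (wterm_le x). Qed.

(** The first term of the series splits off; in the others b^(n+1) (x + i)/b is b^n x plus an
    integer, removed by periodicity. *)
Lemma W_branch (i : 'I_b) x :
  Wfun lam b phi (branch i x) = phi (branch i x) + lam * Wfun lam b phi x.
Proof.
rewrite !WfunE lim_series_recl; last exact: W_cvg.
congr (_ + _); first by rewrite /wterm expr0 !mul1r.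
rewrite -lim_series_scale; last exact: W_cvg.
congr (limn (series _)); apply/funext => n; rewrite /wterm exprS -mulrA; congr (_ * (_ * _)).
rewrite exprSr -mulrA (_ : b%:R * branch i x = x + i%:R); last first.
  by rewrite /branch mulrC divfK// gt_eqF.
by rewrite mulrDr -natrX -natrM phi_shift.
Qed.

Lemma measurable_phi : measurable_fun setT phi.
Proof. exact: continuous_measurable_fun. Qed.

Lemma measurable_W : measurable_fun setT (Wfun lam b phi).
Proof.
apply: (@measurable_fun_cvg _ _ R setT (fun N x => series (wterm x) N)).
  move=> N; rewrite /series/=; apply: measurable_sum => n.
  apply: measurable_funM => //; apply: measurableT_comp; first exact: measurable_phi.
  exact: mulrl_measurable.
by move=> x _; exact: W_cvg.
Qed.

Lemma W_le x : `|Wfun lam b phi x| <= supC / (1 - lam).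
Proof.
have := @geo_tail R (wterm x) supC lam 0 lam01 supC_ge0 _ (wterm_le x).
by rewrite expr0 mulr1; apply.
Qed.

Implicit Types (j : nat -> 'I_b).

Definition cc j n : R := \sum_(0 <= k < n.+1) (j k)%:R / b%:R ^+ (n.+1 - k).

Lemma cc_ge0 j n : 0 <= cc j n.
Proof. by apply: sumr_ge0 => k _; rewrite divr_ge0// exprn_ge0// ltW. Qed.

Lemma ccS j n : cc j n.+1 = (cc j n + (j n.+1)%:R) / b%:R.
Proof.
rewrite /cc big_nat_recr//= subSnn expr1 mulrDl; congr (_ + _).
rewrite mulr_suml; apply: eq_big_nat => k /andP[_ kn].
by rewrite (subSn (ltnW kn)) exprSr invfM mulrA.
Qed.

(** A b-adic fraction with n + 1 digits leaves room for x / b^(n+1), so the arguments of [phi] stay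
    in [0, 1]. *)
Lemma cc_le j n : cc j n <= 1 - b%:R ^- n.+1.
Proof.
elim: n => [|n IH].
  rewrite /cc big_nat1 subn0 expr1 ler_pdivrMr// mulrBl mul1r mulVf ?gt_eqF//.
  by rewrite lerBrDr natr1 ler_nat.
rewrite ccS ler_pdivrMr// mulrBl mul1r [b%:R ^+ n.+2]exprSr invfM -mulrA mulVf ?gt_eqF// mulr1.
have : (j n.+1)%:R + 1 <= b%:R :> R by rewrite natr1 ler_nat.
lra.
Qed.

Lemma cc_cons i j n : cc (scat [:: i] j) n.+1 = i%:R / b%:R ^+ n.+2 + cc j n.
Proof.
rewrite /cc big_nat_recl//= subn0; congr (_ + _).
by apply: eq_big_nat => k _; rewrite subSS /scat/= subn1.
Qed.

Lemma cc_cons0 i j : cc (scat [:: i] j) 0 = i%:R / b%:R.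
Proof. by rewrite /cc big_nat1 subn0 expr1. Qed.

Definition arg j n x : R := x / b%:R ^+ n.+1 + cc j n.

Lemma arg_ge0 j n x : 0 <= x -> 0 <= arg j n x.
Proof. by move=> x0; rewrite addr_ge0 ?cc_ge0// divr_ge0// exprn_ge0// ltW. Qed.

Lemma arg_le1 j n x : x <= 1 -> arg j n x <= 1.
Proof.
move=> x1; have := cc_le j n.
have : x / b%:R ^+ n.+1 <= b%:R ^- n.+1.
  by rewrite -[leRHS]mul1r ler_pM2r// invr_gt0 exprn_gt0.
rewrite /arg; lra.
Qed.

Let term j x (n : nat) : R := lam^-1 ^+ n.+1 * (phi (arg j n x) - phi (cc j n)).

(** The factor lam^-(n+1) grows, but the two arguments of [phi] are only x / b^(n+1) apart, and the
    product is at most g^(n+1). *)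
Lemma term_le j x n : 0 <= x <= 1 -> `|term j x n| <= lipC * g ^+ n.
Proof.
move=> /andP[x0 x1]; have l0 : 0 < lam^-1 ^+ n.+1 by rewrite exprn_gt0// invr_gt0.
rewrite normrM gtr0_norm//.
have xb : 0 <= x / b%:R ^+ n.+1 by rewrite divr_ge0// exprn_ge0// ltW.
have := phi_lip (cc_ge0 j n) _ (arg_le1 j n x1); rewrite /arg => /(_ _) h.
have {}h : `|phi (arg j n x) - phi (cc j n)| <= lipC * (x / b%:R ^+ n.+1).
  by apply: le_trans (h _) _; rewrite ?lerDr// addrK.
apply: (@le_trans _ _ (lam^-1 ^+ n.+1 * (lipC * (x / b%:R ^+ n.+1)))).
  by rewrite ler_pM2l.
rewrite mulrCA ler_wpM2l ?lipC_ge0// mulrCA -exprVn -exprMn mulrC.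
have -> : lam^-1 / b%:R = g by rewrite /g /gam invfM mulrC.
apply: (@le_trans _ _ (g ^+ n.+1)); first by rewrite ler_piMr// exprn_ge0// ltW.
by rewrite exprS ler_piMl ?exprn_ge0// ltW.
Qed.

(* The closed form of [Gam] obtained by integrating the series of [Yfun]. *)
Definition GamS j x : R := - limn (series (term j x)).

Lemma term_cvg j x : 0 <= x <= 1 -> cvgn (series (term j x)).
Proof. by move=> x01; apply: geo_cvg g01 (fun n => term_le j n x01). Qed.

Lemma GamE j x : 0 <= x < 1 -> Gam lam b phi j x = GamS j x.
Proof.
move=> /andP[x0 x1]; rewrite /Gam x0.
(* The constants [phi (cc j k)] of [term] reappear as the values at t = 0. *)
pose h n t := - 1 * \sum_(0 <= k < n) lam^-1 ^+ k.+1 * phi (arg j k t).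
pose G n t := - 1 * \sum_(0 <= k < n) lam^-1 ^+ k.+1 * (derive1 phi (arg j k t) / b%:R ^+ k.+1).
have hG n : pw_deriv (h n) (G n) 0 x.
  apply: pwZ; apply: pw_sum => // k; apply: pwZ; apply: phi_affine_pw => //.
  - by rewrite exprn_gt0.
  - exact: cc_ge0.
  - exact/arg_le1/ltW.
pose u t n := g ^+ n.+1 * derive1 phi (arg j n t).
have ul t n : 0 <= t <= x -> `|u t n| <= lipC * g ^+ n.
  move=> /andP[t0 tx]; rewrite normrM gtr0_norm ?exprn_gt0// mulrC; apply: ler_pM => //.
  - by rewrite exprn_ge0// ltW.
  - by apply: dphi_le; rewrite arg_ge0//= arg_le1// (le_trans tx)// ltW.
  - by rewrite exprS ler_piMl ?exprn_ge0// ltW.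
have GE n t : G n t = - series (u t) n.
  rewrite /G mulN1r; congr (- _); apply: eq_bigr => k _; rewrite /u /g /gam.
  have -> : (b%:R * lam)^-1 = lam^-1 * b%:R^-1 by rewrite invfM mulrC.
  by rewrite exprMn (exprVn b%:R) -mulrA; congr (_ * _); exact: mulrC.
have GL n t : 0 <= t <= x -> `|G n t| <= lipC / (1 - g).
  move=> tx; rewrite GE normrN; apply: le_trans (ler_norm_sum _ _ _) _.
  have h0 (n' : nat) : (n' < 0)%N -> u t n' = 0 by [].
  apply: le_trans (geo_partial g01 lipC_ge0 h0 (fun n => ul t n tx) n) _.
  rewrite ler_wpM2r ?invr_ge0 ?subr_ge0 ?(ltW g1)// ler_piMr ?lipC_ge0//.
  by rewrite expr0 gerBl exprn_ge0// ltW.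
have GY t : 0 <= t <= x -> G ^~ t @ \oo --> Yfun lam b phi t j.
  move=> tx; have -> : G ^~ t = (fun n => - series (u t) n) by apply/funext => n; rewrite GE.
  apply: (@cvgN _ _ _ _ _ (series (u t))).
  exact: (geo_cvg g01 (fun n => ul t n tx)).
have cv := pw_lim x0 hG GL GY.
have cv' : (fun n => h n x - h n 0) @ \oo --> GamS j x.
  have -> : (fun n => h n x - h n 0) = (fun n => - series (term j x) n).
    apply/funext => n; rewrite /h -mulrBr -sumrB mulN1r; congr (- _).
    by apply: eq_bigr => k _; rewrite -mulrBr /term /arg mul0r add0r.
  by apply: cvgN; apply: term_cvg; rewrite x0 ltW.
exact: (cvg_unique (@norm_hausdorff _ R) cv cv').
Qed.

(** Prepending [i] shifts the series: the argument of rank n + 1 at x becomes the one of rank n at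
    (x + i)/b for [j]. The first term yields phi((x + i)/b), which cancels against [W_branch] in
    X. *)
Lemma GamS_branch (i : 'I_b) j x : 0 <= x < 1 ->
  GamS j (branch i x) = lam * GamS (scat [:: i] j) x + phi (branch i x) -
    (phi (i%:R / b%:R) - GamS j (i%:R / b%:R)).
Proof.
move=> x01; have x01' : 0 <= x <= 1 by case/andP: x01 => -> /ltW.
have br01 : 0 <= branch i x <= 1 by have /andP[-> /ltW] := branch01 b2 i x01.
have i01 : 0 <= (i%:R / b%:R : R) <= 1.
  by rewrite divr_ge0//= ler_pdivrMr// mul1r ler_nat ltnW.
rewrite /GamS [limn (series (term (scat _ _) _))]lim_series_recl; last exact: term_cvg.
have e : (fun n => term (scat [:: i] j) x n.+1) = (fun n => lam^-1 * (term j (branch i x) - term j (i%:R / b%:R)) n).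
  apply/funext => n; rewrite /term/= exprS -mulrA; congr (_ * _).
  have -> : (term j (branch i x) - term j (i%:R / b%:R)) n = term j (branch i x) n - term j (i%:R / b%:R) n by [].
  rewrite /term -mulrBr opprB addrA subrK; congr (_ * (phi _ - phi _)).
    rewrite /arg cc_cons addrA -mulrDl /branch; congr (_ + _).
    by rewrite -mulrA -invfM -exprS.
  by rewrite /arg cc_cons; congr (_ + _); rewrite -mulrA -invfM -exprS.
have c1 : cvgn (series (term j (branch i x))) by exact: term_cvg.
have c2 : cvgn (series (term j (i%:R / b%:R))) by exact: term_cvg.
rewrite e lim_series_scale; last exact: is_cvg_seriesB.
have t0 : term (scat [:: i] j) x 0 = lam^-1 * (phi (branch i x) - phi (i%:R / b%:R)).
  by rewrite /term /arg cc_cons0 !expr1 -mulrDl.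
rewrite lim_seriesB// t0.
by field; rewrite gt_eqF.
Qed.

Lemma GamS_le j x : 0 <= x <= 1 -> `|GamS j x| <= lipC / (1 - g).
Proof.
move=> x01; rewrite /GamS normrN.
have := @geo_tail R (term j x) lipC g 0 g01 lipC_ge0 _ (fun n => term_le j n x01).
by rewrite expr0 mulr1; apply.
Qed.

Lemma GamS_close l j j' x : (forall k, (k < l)%N -> j k = j' k) -> 0 <= x <= 1 ->
  `|GamS j x - GamS j' x| <= 2 * lipC / (1 - g) * g ^+ l.
Proof.
move=> jj' x01; have c1 : cvgn (series (term j x)) by exact: term_cvg.
have c2 : cvgn (series (term j' x)) by exact: term_cvg.
rewrite /GamS opprK addrC -lim_seriesB// mulrAC.
apply: geo_tail => //; first by rewrite mulr_ge0// lipC_ge0.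
  move=> n nl; have ccE : cc j' n = cc j n.
    by apply: eq_big_nat => k /andP[_ kn]; rewrite jj'// (leq_trans kn).
  have -> : (term j' x - term j x) n = term j' x n - term j x n by [].
  by rewrite /term /arg ccE subrr.
move=> n; rewrite -mulrA mulr_natl mulr2n; apply: le_trans (ler_normB _ _) _.
by rewrite lerD// term_le.
Qed.

Lemma measurable_GamS j : measurable_fun (`[0, 1[%classic : set R) (GamS j).
Proof.
apply: measurable_funN; apply: (@measurable_fun_cvg _ _ R _ (fun N x => series (term j x) N)).
  move=> N; rewrite /series/=; apply: measurable_sum => n.
  apply: measurable_funM => //; apply: measurable_funB => //.
  apply: measurableT_comp; first exact: measurable_phi.
  by apply: measurable_funD => //; exact: measurable_funM.
by move=> x /=; rewrite in_itv/= => /andP[x0 x1]; apply: term_cvg; rewrite x0 ltW.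
Qed.

(* Cut off outside [0,1[, where [Gam] has not been shown measurable. *)
Definition Xfun j (x : R) : R :=
  ((fun x => pij lam b phi j (x, Wfun lam b phi x)) \_ `[0, 1[) x.

Lemma Xfun_pij j x : 0 <= x < 1 -> Xfun j x = pij lam b phi j (x, Wfun lam b phi x).
Proof. by move=> x01; rewrite /Xfun patchE mem_set//= in_itv. Qed.

Lemma XfunE j x : 0 <= x < 1 -> Xfun j x = Wfun lam b phi x - GamS j x.
Proof. by move=> x01; rewrite Xfun_pij// /pij /= GamE. Qed.

Lemma measurable_Xfun j : measurable_fun setT (Xfun j).
Proof.
apply/(measurable_restrictT _ _).1 => //.
apply: (@eq_measurable_fun _ _ _ _ _ (fun x => Wfun lam b phi x - GamS j x)).
  by move=> x; rewrite inE/= in_itv/= => x01; rewrite /pij/= GamE.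
apply: measurable_funB; last exact: measurable_GamS.
by apply: measurable_funTS; exact: measurable_W.
Qed.

(** A single constant for the supremum of X and for the rate in [Xfun_close]; the 1 makes it
    positive. *)
Definition Xbnd : R := supC / (1 - lam) + 2 * lipC / (1 - g) + 1.

Let l1 : 0 < 1 - lam. Proof. by rewrite subr_gt0. Qed.
Let gg1 : 0 < 1 - g. Proof. by rewrite subr_gt0. Qed.

Lemma Xbnd_gt0 : 0 < Xbnd.
Proof.
by rewrite ltr_wpDl// addr_ge0// divr_ge0// ?(ltW l1) ?(ltW gg1) ?supC_ge0// mulr_ge0// lipC_ge0.
Qed.

Lemma Xfun_le j x : 0 <= x < 1 -> `|Xfun j x| <= Xbnd.
Proof.
move=> x01; have x01' : 0 <= x <= 1 by case/andP: x01 => -> /ltW.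
rewrite XfunE//; apply: le_trans (ler_normB _ _) _.
have := W_le x; have := GamS_le j x01'.
have : 0 <= lipC / (1 - g) by rewrite divr_ge0 ?lipC_ge0// ltW.
rewrite /Xbnd -mulrA; lra.
Qed.

Lemma Xfun_branch i j : exists c, forall x, 0 <= x < 1 ->
  Xfun j (branch i x) = lam * Xfun (scat [:: i] j) x + c.
Proof.
exists (phi (i%:R / b%:R) - GamS j (i%:R / b%:R)) => x x01.
rewrite !XfunE ?branch01// W_branch GamS_branch//; ring.
Qed.

Lemma Xfun_close l j j' : (forall k, (k < l)%N -> j k = j' k) ->
  forall x, 0 <= x < 1 -> `|Xfun j x - Xfun j' x| <= Xbnd * g ^+ l.
Proof.
move=> jj' x x01; have x01' : 0 <= x <= 1 by case/andP: x01 => -> /ltW.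
rewrite !XfunE// opprB addrC addrA subrK distrC; apply: le_trans (GamS_close jj' x01') _.
rewrite ler_wpM2r ?exprn_ge0 ?(ltW g0)// /Xbnd.
have : 0 <= supC / (1 - lam) by rewrite divr_ge0 ?supC_ge0// ltW.
lra.
Qed.

Lemma law_Xfun j : law (Xfun j) = push (pij lam b phi j) (muW lam b phi).
Proof.
apply/funext => A; rewrite /law /push /muW /prob.
have -> : [set x : R | 0 <= x < 1] = `[0, 1[%classic.
  by apply/seteqP; split => x /=; rewrite in_itv.
congr (fine (mu _)); apply/seteqP; split => x [x01] h; split=> //;
have x01' : 0 <= x < 1 by move: x01; rewrite /= in_itv.
  by move: h; rewrite /= Xfun_pij.
by move: h; rewrite /= Xfun_pij.
Qed.

End Weierstrass.

(** * Back to the measures of the statement *)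

(** [level] shows that [xget] does not return its default. The bound n <= hat n, from b lam > 1,
    turns a threshold for word lengths into one for n. *)
Lemma hat_spec {R : realType} {b : nat} (b2 : (2 <= b)%N) (lam : R) n :
  b%:R^-1 < lam < 1 ->
  lam < b%:R ^+ n * lam ^+ hat lam b n <= 1 /\ (n <= hat lam b n)%N.
Proof.
move=> lb; have b0 : 0 < b%:R :> R by rewrite ltr0n (leq_trans _ b2).
have l0 : 0 < lam by case/andP: lb => h _; apply: le_lt_trans h; rewrite invr_ge0 ltW.
have e k : (lam ^ k%:Z <= b%:R ^ (- n%:Z) < lam ^ (k%:Z - 1)) =
    (lam < b%:R ^+ n * lam ^+ k <= 1).
  rewrite expfzDr ?gt_eqF// exprN1 -exprnP -exprnN andbC; congr (_ && _).
    by rewrite ltr_pdivlMr// ltr_pdivrMl// exprn_gt0.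
  by rewrite -[X in _ <= X]mul1r ler_pdivlMr ?exprn_gt0// mulrC.
have [l hl] := level b2 lb n.
have hs : lam < b%:R ^+ n * lam ^+ hat lam b n <= 1.
  rewrite -e; apply: (@xgetPex _ 0%N [set k : nat | lam ^ (k%:Z) <= (b%:R : R) ^ (- (n%:Z)) < lam ^ (k%:Z - 1)]).
  by exists l; rewrite /= e.
split=> //; move: hs => /andP[_]; apply: contraTT; rewrite -!ltnNge -ltNge => hn.
rewrite -[X in b%:R ^+ X * _](subnK (ltnW hn)) exprD -mulrA -exprMn.
have bl : 1 <= (b%:R * lam) ^+ hat lam b n.
  by apply: exprn_ege1; rewrite mulrC -ler_pdivrMr// mul1r; case/andP: lb => /ltW.
apply: lt_le_trans (_ : b%:R ^+ (n - hat lam b n) <= _); last first.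
  by rewrite ler_peMr// exprn_ge0// ltW.
by rewrite exprn_egt1 ?ltr1n// subn_eq0 -ltnNge.
Qed.

Section Interface.
Context {R : realType} {b : nat} (b2 : (2 <= b)%N).

Let b0 : 0 < b%:R :> R. Proof. by rewrite ltr0n (leq_trans _ b2). Qed.

Lemma LintE n (k : int) (y : R) : Lint R b n k y <-> Num.floor (b%:R ^+ n * y) = k.
Proof.
have bn : 0 < b%:R ^+ n :> R by rewrite exprn_gt0.
split.
  by rewrite /Lint/= => /andP[h1 h2]; apply: floor_def; rewrite mulrC -ler_pdivrMr// h1 -ltr_pdivlMr.
move=> <-; have /andP[h1 h2] := floor_itv (b%:R ^+ n * y).
by rewrite /Lint/= ler_pdivrMr// [y * _]mulrC h1 ltr_pdivlMr// [y * _]mulrC.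
Qed.

Variables (F G : R -> R) (T : nat) (z0 : int).
Hypothesis G0 : forall x, 0 <= x < 1 -> 0 <= G x.
Hypothesis FG : forall x, 0 <= x < 1 -> b%:R ^+ T * F x = z0%:~R + G x.

(** Scaling by b^T shifts levels by T, and a translation by an integer permutes the cells of each
    level. *)
Lemma floor_cell i x : 0 <= x < 1 ->
  Num.floor (b%:R ^+ (i + T) * F x) = z0 * (b ^ i)%:Z + (cell (b := b) G i x)%:Z.
Proof.
move=> x01; rewrite exprD -mulrA FG// mulrDr.
have -> : b%:R ^+ i * z0%:~R = (z0 * (b ^ i)%:Z)%:~R :> R.
  by rewrite intrM -pmulrn natrX mulrC.
rewrite floorDzr ?intr_int// intrKfloor; congr (_ + _).
by rewrite /cell truncn_floor mulr_ge0 ?exprn_ge0 ?G0 ?(ltW b0)// gez0_abs// floor_ge0 mulr_ge0 ?exprn_ge0 ?G0 ?(ltW b0).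
Qed.

Lemma law_Lcell i x : 0 <= x < 1 ->
  law F (Lcell b (i + T) (F x)) = pc (b := b) G i (cell (b := b) G i x).
Proof.
move=> x01; apply: eq_prob => x' x01'; rewrite /= /Lcell LintE !floor_cell//.
split => [/addrI[]//|->//].
Qed.

Lemma law_Lint i m r x : 0 <= x < 1 -> (r < b ^ m)%N ->
  law F (Lint R b (i + T + m)
     (Num.floor (b%:R ^+ (i + T) * F x) * (b ^ m)%:Z + r%:Z) `&` Lcell b (i + T) (F x)) =
  pc (b := b) G (i + m) (cell (b := b) G i x * b ^ m + r).
Proof.
move=> x01 rm; apply: eq_prob => x' x01'.
rewrite /= /Lcell /setI/= !LintE addnAC !floor_cell// expnD PoszM mulrDl -mulrA -addrA.
rewrite (cell_div b2 i m (G0 x01')); split.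
  by case=> /addrI; rewrite -PoszM -PoszD => -[].
move=> ->; split; first by rewrite -PoszM -PoszD.
by rewrite divnMDl ?expn_gt0 ?(leq_trans _ b2)// divn_small// addn0.
Qed.

Lemma Hloc_law i m x : 0 <= x < 1 ->
  Hloc b (law F) (i + T) m (F x) = Hl (b := b) G i m (cell (b := b) G i x) / ln b%:R.
Proof.
move=> x01; rewrite /Hloc /Hl mulNr; congr (- _).
rewrite mulr_suml; apply: eq_bigr => r _; rewrite law_Lint// law_Lcell// /plogb.
by case: eqP => [->|_]; rewrite ?mul0r// mulrA.
Qed.

Lemma gporous_entropy_porous al eps m k :
  gporous (b := b) al G eps m k -> entropy_porous b (law F) al eps m (T + 1) (T + k).
Proof.
rewrite /gporous /entropy_porous [(T + 1)%N]addnC big_addn.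
have -> : ((T + k).+1 - (1 + T) = k)%N by lia.
have -> : ((T + k).+1 - T = k.+1)%N by lia.
set s1 := \sum_(_ <= _ < _) _; set s2 := (X in _ -> _ < _ * X); suff -> : s1 = s2 by [].
apply: eq_bigr => i _; apply: eq_prob => x x01.
by rewrite /= law_Lcell// Hloc_law.
Qed.

End Interface.

Lemma floor_range {R : realType} (X p q z B : R) :
  - X <= p <= X -> z <= q - X -> q - X < z + 1 -> 2 * X + 1 < B -> 0 <= p + (q - z) < B.
Proof. by move=> /andP[? ?] ? ? ?; apply/andP; split; lra. Qed.

Section Final.
Context {R : realType} {b : nat} (b2 : (2 <= b)%N).
Variables (lam : R) (phi : R -> R).
Hypothesis lam_bnd : b%:R^-1 < lam < 1.
Hypothesis phi_per : Zperiodic phi.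
Hypothesis phi_pw : piecewise_C2 phi.

Let graph (x : R) := (x, Wfun lam b phi x).

Lemma gword_graph (w : seq 'I_b) x : gword lam b phi w (graph x) = graph (Hw (rev w) x).
Proof.
elim: w x => [//|i w IH] x; rewrite rev_cons -cats1 Hw_cat /= IH /gmap /graph /=.
by congr pair; rewrite (W_branch b2 lam_bnd phi_per phi_pw) addrC.
Qed.

Lemma law_gword (j : nat -> 'I_b) (u w : seq 'I_b) :
  push (pij lam b phi j) (push (gword lam b phi u) (push (gword lam b phi w) (muW lam b phi)))
  = law (fun x => Xfun lam phi j (Hw (rev w ++ rev u) x)).
Proof.
apply/funext => A; rewrite /law /push /muW /prob.
have -> : [set x : R | 0 <= x < 1] = `[0, 1[%classic.
  by apply/seteqP; split => x /=; rewrite in_itv.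
congr (fine (lebesgue_measure _)).
have E (x : R) : `[0, 1[%classic x -> (gword lam b phi w @^-1` (gword lam b phi u @^-1` (pij lam b phi j @^-1` A)))
    (x, Wfun lam b phi x) <-> A (Xfun lam phi j (Hw (rev w ++ rev u) x)).
  rewrite /= in_itv/= => x01; rewrite -/(graph x) !gword_graph Hw_cat Xfun_pij//.
  by apply: (Hw01 b2 (rev u)); apply: (Hw01 b2).
by apply/seteqP; split => x [x01 h]; split=> //; apply/E.
Qed.

(** In [porous_words] the translation [d] lies in [Xb, Xb + 1) and |th X| <= Xb, so the rescaled
    values lie in [0, 2 Xb + 1). *)
Definition Xrange : nat := (Num.truncn (2 * @Xbnd R b lam phi phi_pw + 1)).+1.

(** The assumption concerns [w] alone: [u] and [j] only enter through the tail z, the scale th and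
    the translation c, all quantified there. *)
Lemma porous_words (w u : seq 'I_b) (j : nat -> 'I_b) (al eps : R) (m k n t : nat) :
  size w = hat lam b n -> size u = hat lam b t ->
  ~ (exists z th c, admissible lam (Xfun lam phi) (rev w) z th c Xrange /\
       ~ gporous (b := b) al (rescaled (Xfun lam phi) (rev w) z th c) eps m k) ->
  entropy_porous b
    (push (pij lam b phi j) (push (gword lam b phi u)
       (push (gword lam b phi w) (muW lam b phi))))
    al eps m (t + n + 1) (t + n + k).
Proof.
move=> sw su good; have [hn _] := hat_spec b2 n lam_bnd; have [ht _] := hat_spec b2 t lam_bnd.
set Xb := @Xbnd R b lam phi phi_pw.
have b0 : 0 < b%:R :> R by rewrite ltr0n (leq_trans _ b2).
have l0 : 0 < lam by case/andP: lam_bnd => h _; apply: le_lt_trans h; rewrite invr_ge0 ltW.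
have [c hc] := X_Hw b2 (Xfun_branch b2 lam_bnd phi_per phi_pw) (rev w ++ rev u) j.
rewrite law_gword; set F := fun x => _.
pose th := b%:R ^+ (t + n) * lam ^+ size (rev w ++ rev u).
have thE : th = (b%:R ^+ n * lam ^+ hat lam b n) * (b%:R ^+ t * lam ^+ hat lam b t).
  by rewrite /th size_cat !size_rev sw su !exprD; ring.
have th1 : lam ^+ 2 < th <= 1.
  move: hn ht => /andP[n1 n2] /andP[t1 t2]; rewrite thE expr2; apply/andP; split.
    by rewrite ltr_pM// ltW.
  by rewrite mulr_ile1// ltW// (lt_trans l0).
have th0 : 0 < th by case/andP: th1 => h _; apply: lt_trans h; rewrite exprn_gt0.
pose z0 := Num.floor (b%:R ^+ (t + n) * c - Xb).
pose d := b%:R ^+ (t + n) * c - z0%:~R.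
have /andP[d1 d2] := floor_itv (b%:R ^+ (t + n) * c - Xb).
rewrite -/z0 intrD in d1 d2.
have adm : admissible lam (Xfun lam phi) (rev w) (scat (rev u) j) th d Xrange.
  split=> // x x01; rewrite -scat_cat.
  have hX : `|th * Xfun lam phi (scat (rev w ++ rev u) j) x| <= Xb.
    rewrite normrM gtr0_norm//; apply: le_trans (Xfun_le b2 lam_bnd phi_per phi_pw (scat (rev w ++ rev u) j) x01).
    by rewrite ler_piMl//; case/andP: th1.
  have Xb0 : 0 <= Xb by apply: le_trans hX.
  have y0 : 0 <= 2 * Xb + 1 by rewrite addr_ge0// mulr_ge0.
  have /andP[_] := truncn_itv y0; rewrite -/Xrange => h3.
  by move: hX d1 d2 h3; rewrite ler_norml; exact: floor_range.
have gp : gporous (b := b) al (rescaled (Xfun lam phi) (rev w) (scat (rev u) j) th d) eps m k.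
  by apply: contrapT => ng; apply: good; exists (scat (rev u) j), th, d.
apply: (gporous_entropy_porous b2 (F := F) (T := (t + n)%N) (z0 := z0) _ _ gp).
  by move=> x x01; have [_ /(_ x x01)/andP[]] := adm.
by move=> x x01; rewrite /F hc// /rescaled -scat_cat /d /th; ring.
Qed.

End Final.

Unset Implicit Arguments.
Unset Strict Implicit.

Theorem mainTheorem14 (R : realType) (b : nat) (lam : R) (phi : R -> R)
    (alpha : R) :
  (2 <= b)%N ->
  (b%:R)^-1 < lam < 1 ->
  Zperiodic phi -> continuous phi -> piecewise_C2 phi ->
  ~ lipschitz (Wfun lam b phi) ->
  (* alpha is Ledrappier's constant: pi_j mu is exact-dimensional of
     dimension alpha for nu^{Z_+}-a.e. j *)
  nu_outer R b [set j | ~ exact_dim (push (pij lam b phi j) (muW lam b phi)) alpha]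
    = 0%E ->
  forall eps : R, 0 < eps ->
  exists M : nat, forall m : nat, (M <= m)%N ->
  exists K : nat, forall k : nat, (K <= k)%N ->
  exists N : nat, forall n : nat, (N <= n)%N ->
  forall (t : nat) (j : nat -> 'I_b) (u : (hat lam b t).-tuple 'I_b),
    (nu_outer R b
      [set i : nat -> 'I_b |
        entropy_porous b
          (push (pij lam b phi j)
            (push (gword lam b phi u)
              (push (gword lam b phi [seq i k | k <- iota 0 (hat lam b n)])
                (muW lam b phi))))
          alpha eps m (t + n + 1) (t + n + k)]
     > (1 - eps)%:E)%E.
Proof.
move=> b2 lb per cont pw _ ed eps eps0.
have b0 : 0 < b%:R :> R by rewrite ltr0n (leq_trans _ b2).
have l0 : 0 < lam by case/andP: lb => h _; apply: le_lt_trans h; rewrite invr_ge0 ltW.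
have g01 : 0 <= gam lam b < 1.
  rewrite /gam invr_ge0 mulr_ge0 ?(ltW l0)// invf_lt1 ?mulr_gt0// mulrC -ltr_pdivrMr// mul1r.
  by case/andP: lb.
have ed' : nu_outer R b [set j | ~ exact_dim (law (Xfun lam phi j)) alpha] = 0%E.
  by rewrite -ed; congr (nu_outer R b _); apply/funext => j /=; rewrite law_Xfun.
have [M HM] := core_porous b2 lb g01 (Xbnd_gt0 b2 lb pw)
  (measurable_Xfun b2 lb per cont pw) (Xfun_le b2 lb per pw)
  (Xfun_branch b2 lb per pw) (Xfun_close b2 lb pw) ed' (@Xrange R b lam phi pw) eps0.
exists M => m /HM[K HK]; exists K => k /HK[N HN]; exists N => n Nn t j u.
have [_ nh] := hat_spec b2 n lb.
have {}HN := HN _ (leq_trans Nn nh).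
rewrite -avg_rev in HN; set bad := fun w => _ in HN.
pose S w := entropy_porous b (push (pij lam b phi j) (push (gword lam b phi u)
   (push (gword lam b phi w) (muW lam b phi)))) alpha eps m (t + n + 1) (t + n + k).
(* The event depends only on the first [hat lam b n] letters, so its outer measure is at least the
   proportion of words in [S]. *)
apply: lt_le_trans (nu_outer_avg b2 (hat lam b n) S).
rewrite lte_fin; apply: (@lt_le_trans _ _ (1 - eps / 2)); first by lra.
rewrite lerBlDr -[X in X <= _](avg_cst b2 (hat lam b n) 1).
apply: le_trans (lerD (lexx _) HN); rewrite -avgD; apply: avg_le => w sw.
apply: le_trans (ind_or _ _); rewrite -[X in X <= _](@ind1 R True I); apply: ind_mono => _.
have [h|h] := pselect (exists z th c, admissible lam (Xfun lam phi) (rev w) z th c (@Xrange R b lam phi pw) /\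
       ~ gporous (b := b) alpha (rescaled (Xfun lam phi) (rev w) z th c) eps m k).
  by right.
by left; exact: (@porous_words R b b2 lam phi lb per pw w u j alpha eps m k n t sw (size_tuple u) h).
Qed.
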